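(* The theory of rooted ordered combinatorial trees whose order relation is an equivalence relation is VC-complete; that is, if the $\mathcal{L}_{\omega_1\omega}$-sentence axiomatizing this class strongly satisfies Vaught's conjecture, then Vaught's conjecture holds. The same holds for the theory of (unrooted) ordered combinatorial trees whose order relation is an equivalence relation.
   Context: An ordered combinatorial tree is a structure $\langle U, G,\le\rangle$ where $\langle U,G\rangle$ is a connected acyclic graph and $\le$ is a transitive binary relation; a rooted one additionally has a distinguished vertex (the root). Vaught's conjecture: for every countable language $\mathcal{L}$ and every $\mathcal{L}_{\omega_1\omega}$-sentence $\varphi$, $\varphi$ has either at most countably many or perfectly many (a perfect set of pairwise) non-isomorphic countable models. An $\mathcal{L}_{\omega_1\omega}$-sentence $\varphi$ strongly satisfies Vaught's conjecture if for every $\mathcal{L}_{\omega_1\omega}$-sentence $\psi$ with $\psi\Rightarrow\varphi$, $\psi$ has either at most countably many or perfectly many non-isomorphic countable models (equivalently, every isomorphism-invariant Borel subset of $Mod_\varphi$ has either countably many or perfectly many isomorphism classes). A theory is VC-complete if its strongly satisfying Vaught's conjecture implies Vaught's conjecture. *)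

(* Defs.v *)
From HB Require Import structures.
From mathcomp Require Import all_boot all_classical topology.

Set Implicit Arguments.
Unset Strict Implicit.
Unset Printing Implicit Defensive.

Local Open Scope classical_set_scope.

Record language := Language {
  fsym : countType;
  fun_arity : fsym -> nat;
  rsym : countType;
  rel_arity : rsym -> nat }.

(* The interpretations of all symbols are uncurried into one function on pairs
   (symbol, arguments), so that [structure_space] below is a plain product. *)
Definition structure (L : language) (T : Type) : Type :=
  (({f : fsym L & (fun_arity f).-tuple T} -> T) *
   ({r : rsym L & (rel_arity r).-tuple T} -> bool))%type.

Section Structures.
Variable L : language.

Definition fun_interp (T : Type) (M : structure L T) (f : fsym L)
    (t : (fun_arity f).-tuple T) : T :=
  M.1 (existT (fun f => (fun_arity f).-tuple T) f t).

Definition rel_interp (T : Type) (M : structure L T) (r : rsym L)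
    (t : (rel_arity r).-tuple T) : bool :=
  M.2 (existT (fun r => (rel_arity r).-tuple T) r t).

Definition isomorphic (T U : Type) (M : structure L T) (N : structure L U) :=
  exists h : T -> U, [/\ bijective h,
    forall (f : fsym L) (t : (fun_arity f).-tuple T),
      h (fun_interp M t) = fun_interp N (map_tuple h t) &
    forall (r : rsym L) (t : (rel_arity r).-tuple T),
      rel_interp M t = rel_interp N (map_tuple h t)].

(* The usual Polish topology on the L-structures with universe T: the product
   of copies of the discrete spaces T and bool. *)
Definition structure_space (T : countType) : topologicalType :=
  (prod_topology (fun _ : {f : fsym L & (fun_arity f).-tuple T} =>
     discrete_topology T) *
   prod_topology (fun _ : {r : rsym L & (rel_arity r).-tuple T} =>
     discrete_topology bool))%type.

(* Universes of structures are nonempty; countable includes finite. *)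
Record countable_structure := CountableStructure {
  universe : countType;
  universe_inh : inhabited universe;
  interp :> structure L universe }.

(* Formulas are well scoped: those in [formula n] have their free variables
   among n variables, and a quantifier binds variable [ord0]. *)
Inductive term (n : nat) : Type :=
| Var of 'I_n
| App (f : fsym L) of ('I_(fun_arity f) -> term n).

Inductive formula : nat -> Type :=
| Equal n of term n & term n : formula n
| Rel n (r : rsym L) of ('I_(rel_arity r) -> term n) : formula n
| Not n of formula n : formula n
| And n of (nat -> formula n) : formula n
| Exists n of formula n.+1 : formula n.

Definition sentence := formula 0.

Fixpoint eval (T : Type) (M : structure L T) n (e : 'I_n -> T) (t : term n) :
    T :=
  match t with
  | Var i => e i
  | App f a => fun_interp M [tuple eval M e (a i) | i < fun_arity f]
  end.

Definition push (T : Type) n (x : T) (e : 'I_n -> T) : 'I_n.+1 -> T :=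
  fun i => if unlift ord0 i is Some j then e j else x.

Fixpoint holds (T : Type) (M : structure L T) n (F : formula n) :
    ('I_n -> T) -> Prop :=
  match F in formula n return ('I_n -> T) -> Prop with
  | Equal _ s t => fun e => eval M e s = eval M e t
  | Rel _ r a => fun e => rel_interp M [tuple eval M e (a i) | i < rel_arity r]
  | Not _ G => fun e => ~ holds M G e
  | And _ G => fun e => forall k, holds M (G k) e
  | Exists _ G => fun e => exists x, holds M G (push x e)
  end.

Definition satisfies (T : Type) (M : structure L T) (phi : sentence) : Prop :=
  holds M phi (fun i : 'I_0 => False_rect T (notF (ltn_ord i))).

Definition entails (psi phi : sentence) : Prop :=
  forall (T : Type) (M : structure L T), inhabited T ->
    satisfies M psi -> satisfies M phi.

Definition countably_many_models (phi : sentence) : Prop :=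
  exists M : nat -> countable_structure,
    forall N : countable_structure,
      satisfies N phi -> exists k, isomorphic N (M k).

(* A set of structures on a fixed nonempty countable universe, which may be
   finite.  [perfect_set] alone does not exclude the empty set. *)
Definition perfectly_many_models (phi : sentence) : Prop :=
  exists (T : countType) (P : set (structure_space T)),
    [/\ inhabited T, P !=set0, perfect_set P,
        forall M : structure_space T, P M -> satisfies M phi &
        forall M N : structure_space T, P M -> P N -> isomorphic M N -> M = N].

Definition satisfies_VC (phi : sentence) : Prop :=
  countably_many_models phi \/ perfectly_many_models phi.

Definition strongly_satisfies_VC (phi : sentence) : Prop :=
  forall psi : sentence, entails psi phi -> satisfies_VC psi.

End Structures.

Definition Vaught_conjecture : Prop :=
  forall (L : language) (phi : sentence L), satisfies_VC phi.

Definition VC_complete (L : language) (phi : sentence L) : Prop :=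
  strongly_satisfies_VC phi -> Vaught_conjecture.

Section Connectives.
Variable L : language.

Definition Forall n (F : formula L n.+1) : formula L n := Not (Exists (Not F)).

Definition Or n (F : nat -> formula L n) : formula L n :=
  Not (And (fun k => Not (F k))).

Definition Top n : formula L n := Forall (Equal (Var L ord0) (Var L ord0)).

(* Conjunction over an arbitrary countable index type. *)
Definition And_over (I : countType) n (F : I -> formula L n) : formula L n :=
  And (fun k => if unpickle k is Some i then F i else Top n).

Definition And2 n (F G : formula L n) : formula L n :=
  And_over (fun b : bool => if b then F else G).

Definition Imp n (F G : formula L n) : formula L n := Not (And2 F (Not G)).

Fixpoint Exists_closure n : formula L n -> sentence L :=
  match n with
  | 0 => fun F => F
  | m.+1 => fun F => Exists_closure (Exists F)
  end.

Fixpoint Forall_closure n : formula L n -> sentence L :=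
  match n with
  | 0 => fun F => F
  | m.+1 => fun F => Forall_closure (Forall F)
  end.

End Connectives.

(* The language of graphs with an order relation and a set C of constants:
   C is [void] for unrooted trees, [unit] for rooted trees.  The relation
   symbol [true] is the adjacency relation, [false] the order relation. *)
Definition tree_language (C : countType) : language :=
  @Language C (fun _ => 0) bool (fun _ => 2).

Section Trees.
Variable C : countType.
Local Notation L := (tree_language C).

Definition binary (r : rsym L) n (i j : 'I_n) : formula L n :=
  @Rel L n r (fun k : 'I_2 => if k == ord0 then Var L i else Var L j).

Definition Adj := binary true.
Definition Ord := binary false.

Let v3 (k : nat) : 'I_3 := inord k.

Definition graph_sentence : sentence L :=
  And2 (Forall_closure (Not (Adj (ord0 : 'I_1) ord0)))
       (Forall_closure (Imp (Adj (ord0 : 'I_2) ord_max) (Adj ord_max ord0))).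

(* There is a walk with k edges from variable i to variable j. *)
Fixpoint Walk k n (i j : 'I_n) : formula L n :=
  if k is k'.+1 then
    Exists (And2 (Adj (lift ord0 i) ord0) (Walk k' ord0 (lift ord0 j)))
  else Equal (Var L i) (Var L j).

Definition connected_sentence : sentence L :=
  Forall_closure (Or (fun k => Walk k (ord0 : 'I_2) ord_max)).

(* Cycles have at least three vertices; [ordS] is the cyclic successor. *)
Definition acyclic_sentence : sentence L :=
  And (fun n => Not (Exists_closure (And2
    (And_over (fun i : 'I_n.+3 => Adj i (ordS i)))
    (And_over (fun ij : 'I_n.+3 * 'I_n.+3 =>
       if ij.1 == ij.2 then Top L n.+3
       else Not (Equal (Var L ij.1) (Var L ij.2))))))).

Definition equivalence_sentence : sentence L :=
  And2 (Forall_closure (Ord (ord0 : 'I_1) ord0))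
  (And2 (Forall_closure (Imp (Ord (ord0 : 'I_2) ord_max) (Ord ord_max ord0)))
        (Forall_closure (Imp (And2 (Ord (v3 0) (v3 1)) (Ord (v3 1) (v3 2)))
                             (Ord (v3 0) (v3 2))))).

Definition tree_equivalence_sentence : sentence L :=
  And2 (And2 graph_sentence (And2 connected_sentence acyclic_sentence))
       equivalence_sentence.

End Trees.

Definition unrooted_sentence : sentence (tree_language void) :=
  tree_equivalence_sentence void.

Definition rooted_sentence : sentence (tree_language unit) :=
  tree_equivalence_sentence unit.

(* The class axiomatized by [tree_equivalence_sentence], in semantic terms. *)
Definition is_tree (T : Type) (G : rel T) : Prop :=
  [/\ irreflexive G, symmetric G,
      forall x y, exists p : seq T, path G x p /\ last x p = y &
      forall n (c : 'I_n.+3 -> T),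
        injective c -> ~ (forall i, G (c i) (c (ordS i)))].

Section Axiomatization.
Variable L : language.
Variables (T : Type) (M : structure L T).

Lemma holds_Forall n (F : formula L n.+1) e :
  holds M (Forall F) e <-> forall x, holds M F (push x e).
Proof.
split=> [/= + x|H [x nF]]; last by apply: nF; exact: H.
by move=> nF; apply: contrapT => nFx; apply: nF; exists x.
Qed.

Lemma holds_Or n (F : nat -> formula L n) e :
  holds M (Or F) e <-> exists k, holds M (F k) e.
Proof.
split=> [/= nF|[k Fk] H]; last exact: (H k).
by apply: contrapT => nE; apply: nF => k Fk; apply: nE; exists k.
Qed.

Lemma holds_Top n e : holds M (Top L n) e.
Proof. by apply/holds_Forall. Qed.

Lemma holds_And_over (I : countType) n (F : I -> formula L n) e :
  holds M (And_over F) e <-> forall i, holds M (F i) e.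
Proof.
split=> [H i|H k /=]; first by have := H (pickle i); rewrite pickleK.
by case: unpickle => [i|]; [exact: H|exact: holds_Top].
Qed.

Lemma holds_And2 n (F G : formula L n) e :
  holds M (And2 F G) e <-> holds M F e /\ holds M G e.
Proof.
split=> [/holds_And_over H|[HF HG]]; first by split; [exact: (H true)|exact: (H false)].
by apply/holds_And_over => -[].
Qed.

Lemma holds_Imp n (F G : formula L n) e :
  holds M (Imp F G) e <-> (holds M F e -> holds M G e).
Proof.
split=> [H HF|H /holds_And2[/H HG]]; last exact.
by apply: contrapT => HG; apply: H; apply/holds_And2.
Qed.

Lemma push_eta n (e : 'I_n.+1 -> T) :
  push (e ord0) (fun i => e (lift ord0 i)) = e.
Proof. by apply: funext => i; rewrite /push; case: unliftP => [j|] ->. Qed.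

Lemma env0 (e e' : 'I_0 -> T) : e = e'.
Proof. by apply: funext => -[]. Qed.

Lemma satisfies_holds (F : sentence L) e : satisfies M F <-> holds M F e.
Proof. by rewrite /satisfies (env0 (fun i : 'I_0 => False_rect T (notF (ltn_ord i))) e). Qed.

Lemma satisfies_Exists_closure n (F : formula L n) :
  satisfies M (Exists_closure F) <-> exists e, holds M F e.
Proof.
elim: n F => [|n IH] F /=.
  by split=> [H|[e /satisfies_holds]//]; eexists; exact: H.
rewrite IH; split=> [[e /= [x]]|[e He]]; first by exists (push x e).
by exists (fun i => e (lift ord0 i)); exists (e ord0); rewrite push_eta.
Qed.

Lemma satisfies_Forall_closure n (F : formula L n) :
  satisfies M (Forall_closure F) <-> forall e, holds M F e.
Proof.
elim: n F => [|n IH] F /=.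
  by split=> [H e|H]; [exact/satisfies_holds|exact: H].
rewrite IH; split=> [H e|H e]; last by apply/holds_Forall.
by have /holds_Forall/(_ (e ord0)) := H (fun i => e (lift ord0 i)); rewrite push_eta.
Qed.

Lemma satisfies_And2 (F G : sentence L) :
  satisfies M (And2 F G) <-> satisfies M F /\ satisfies M G.
Proof. exact: holds_And2. Qed.

End Axiomatization.

Section TreeAxiomatization.
Variables (C : countType) (T : Type) (M : structure (tree_language C) T).

Definition adj : rel T :=
  fun x y => @rel_interp (tree_language C) T M true [tuple x; y].
Definition order_rel : rel T :=
  fun x y => @rel_interp (tree_language C) T M false [tuple x; y].

Lemma holds_binary r n (i j : 'I_n) e :
  holds M (binary (C := C) r i j) e <->
  @rel_interp (tree_language C) T M r [tuple e i; e j].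
Proof.
rewrite /=; set t := mktuple _; suff -> : t = [tuple e i; e j] by [].
by apply: eq_from_tnth => k; rewrite tnth_mktuple; case: k => [[|[|]]].
Qed.

Lemma holds_Walk k n (i j : 'I_n) e :
  holds M (Walk C k i j) e <->
  exists p, [/\ size p = k, path adj (e i) p & last (e i) p = e j].
Proof.
elim: k n i j e => [|k IH] n i j e.
  split=> [/= H|[p [/size0nil-> _ /= ->]]]//; by exists [::].
split=> [[x /holds_And2[/holds_binary + /IH[p [sp pp lp]]]]|].
  move: pp lp; rewrite /push unlift_none !liftK => pp lp a; exists (x :: p).
  by split=> //=; [rewrite sp|rewrite [adj _ _]a].
case=> -[[]//|x p [/= [sp] /andP[a pp] lp]]; exists x; apply/holds_And2; split.
  by apply/holds_binary; rewrite /push unlift_none liftK.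
by apply/IH; exists p; rewrite /push unlift_none liftK.
Qed.

Definition env2 (x y : T) (i : 'I_2) := if i == ord0 then x else y.
Definition env3 (x y z : T) (i : 'I_3) := nth x [:: x; y; z] i.

Theorem tree_equivalence_sentenceP :
  satisfies M (tree_equivalence_sentence C) <->
  is_tree adj /\ [/\ reflexive order_rel, symmetric order_rel & transitive order_rel].
Proof.
have symP r : satisfies M (Forall_closure (Imp
    (binary (C := C) r (ord0 : 'I_2) ord_max) (binary r ord_max ord0))) <->
  symmetric (fun x y => @rel_interp (tree_language C) T M r [tuple x; y]).
  rewrite satisfies_Forall_closure; split=> [H x y|H e]; last first.
    by rewrite holds_Imp !holds_binary H.
  have S u v : @rel_interp (tree_language C) T M r [tuple u; v] ->
      @rel_interp (tree_language C) T M r [tuple v; u].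
    by move: (H (env2 u v)); rewrite holds_Imp !holds_binary.
  by apply/idP/idP; exact: S.
rewrite 6!satisfies_And2 !symP; split.
  case=> -[[irr sG] [con acy]] [refE [sE trE]]; split; split=> //.
  - move=> x; apply/negP; move/satisfies_Forall_closure: irr => /(_ (fun _ => x)).
    by move=> /= H ?; apply: H; apply/holds_binary.
  - move=> x y; move/satisfies_Forall_closure: con => /(_ (env2 x y)).
    by move=> /holds_Or[k /holds_Walk[p []]]; exists p.
  - move=> n c ic H; apply: (acy n); apply/satisfies_Exists_closure; exists c.
    apply/holds_And2; split; apply/holds_And_over.
      by move=> i; apply/holds_binary; exact: H.
    move=> [i j] /=; case: eqP => [_|ne]; first exact: holds_Top.
    by move=> /= /ic.
  - move=> x; move/satisfies_Forall_closure: refE => /(_ (fun _ => x)).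
    by move/holds_binary.
  - move=> y x z xy yz.
    move/satisfies_Forall_closure: trE => /(_ (env3 x y z)).
    rewrite holds_Imp holds_And2 !holds_binary /env3 !inordK//=; exact.
case=> -[irr sG con acy] [refE sE trE]; split; [split; split=> //|split; last split=> //].
- by apply/satisfies_Forall_closure => e /holds_binary; rewrite -/(adj _ _) irr.
- apply/satisfies_Forall_closure => e; apply/holds_Or.
  have [p [pp lp]] := con (e ord0) (e ord_max).
  by exists (size p); apply/holds_Walk; exists p.
- move=> n /satisfies_Exists_closure[c /holds_And2[]].
  move=> /holds_And_over H /holds_And_over I; apply: (acy n c).
    move=> i j cij; apply: contrapT => /eqP ne.
    by have := I (i, j); rewrite /= (negPf ne) /=; exact.
  by move=> i; have /holds_binary := H i.
- by apply/satisfies_Forall_closure => e; apply/holds_binary; exact: refE.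
- apply/satisfies_Forall_closure => e.
  rewrite holds_Imp holds_And2 !holds_binary => -[]; exact: trE.
Qed.

End TreeAxiomatization.

(* Main.v *)
From HB Require Import structures.
From mathcomp Require Import all_boot all_classical topology cantor.
Require Import Defs.

Set Implicit Arguments.
Unset Strict Implicit.
Unset Printing Implicit Defensive.

Local Open Scope classical_set_scope.

(** A countable L-structure M on A is coded by the tree of the words None^m c
    with c a string over A, ordered by one-letter extension, in which two words
    are equivalent when they end with the same letter.  A further None after a
    nonempty c records that the m-th basic fact holds at c; every atomic fact
    and its negation have their own m.  Infinitary formulas axiomatize the trees
    of this form and express satisfaction in the coded structure, so a sentence
    phi becomes a sentence psi about trees, and M is recovered from its tree up
    to isomorphism.  Countably many models of psi thus give countably many
    models of phi.

    For perfect sets, first split phi according to the cardinality of its models,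
    so that all of them live on a fixed set K.  Given a perfect set P of pairwise
    non-isomorphic trees, the root is Sigma_2-definable, hence by the Baire
    category theorem it is constant on a nonempty relatively open part of P.
    Enumerating the children of the root outside its class by their rank, the
    coded structure becomes a structure on K that depends continuously on the
    tree, because both a fact and its negation are witnessed by finite paths.
    Composing with a copy of the Cantor space inside P yields a compact perfect
    set of models of phi. *)

(** * Isomorphisms and definability *)

Section Isomorphism.
Variable L : language.

Definition is_iso (T U : Type) (M : structure L T) (N : structure L U)
    (h : T -> U) : Prop :=
  [/\ bijective h,
    forall (f : fsym L) (t : (fun_arity f).-tuple T),
      h (fun_interp M t) = fun_interp N (map_tuple h t) &
    forall (r : rsym L) (t : (rel_arity r).-tuple T),
      rel_interp M t = rel_interp N (map_tuple h t)].

Lemma is_iso_sym (T U : Type) (M : structure L T) (N : structure L U) h h' :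
  cancel h h' -> cancel h' h -> is_iso M N h -> is_iso N M h'.
Proof.
move=> hK h'K [_ hf hr]; split; first by exists h.
  move=> f t; rewrite -[in LHS](_ : map_tuple h (map_tuple h' t) = t).
    by rewrite -hf hK.
  by apply: eq_from_tnth => i; rewrite !tnth_map h'K.
move=> r t; rewrite -[in LHS](_ : map_tuple h (map_tuple h' t) = t) -?hr //.
by apply: eq_from_tnth => i; rewrite !tnth_map h'K.
Qed.

Lemma is_iso_comp (T U V : Type) (M : structure L T) (N : structure L U)
    (K : structure L V) h k :
  is_iso M N h -> is_iso N K k -> is_iso M K (fun x => k (h x)).
Proof.
move=> [bh hf hr] [bk kf kr]; split; first exact: bij_comp bk bh.
  move=> f t; rewrite hf kf; congr (fun_interp K _).
  by apply: eq_from_tnth => i; rewrite !tnth_map.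
move=> r t; rewrite hr kr; congr (rel_interp K _).
by apply: eq_from_tnth => i; rewrite !tnth_map.
Qed.

Lemma isomorphic_sym (T U : Type) (M : structure L T) (N : structure L U) :
  isomorphic M N -> isomorphic N M.
Proof.
case=> h ih; have [[h' hK h'K] _ _] := ih; exists h'.
exact: is_iso_sym hK h'K ih.
Qed.

Lemma isomorphic_trans (T U V : Type) (M : structure L T) (N : structure L U)
    (K : structure L V) :
  isomorphic M N -> isomorphic N K -> isomorphic M K.
Proof. by case=> h ih [k ik]; eexists; exact: is_iso_comp ih ik. Qed.

Lemma push_comp (T U : Type) (h : T -> U) n (x : T) (e : 'I_n -> T) :
  (fun i => h (push x e i)) = push (h x) (fun i => h (e i)).
Proof. by apply: funext => i; rewrite /push; case: unlift. Qed.

Section Invariance.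
Variables (T U : Type) (M : structure L T) (N : structure L U) (h : T -> U).
Hypothesis ih : is_iso M N h.

Lemma eval_iso n (s : term L n) e : h (eval M e s) = eval N (fun i => h (e i)) s.
Proof.
have [_ hf _] := ih; elim: s => //= f a IHa; rewrite hf; congr (fun_interp N _).
by apply: eq_from_tnth => i; rewrite tnth_map !tnth_mktuple.
Qed.

Lemma holds_iso n (F : formula L n) e :
  holds M F e <-> holds N F (fun i => h (e i)).
Proof.
have [[h' hK h'K] _ hr] := ih.
elim: F e => {n} [n s t|n r a|n F IHF|n F IHF|n F IHF] e /=.
- by rewrite -!eval_iso; split=> [->//|/(can_inj hK)].
- rewrite hr; set t1 := map_tuple _ _; set t2 := mktuple _.
  suff -> : t1 = t2 by [].
  by apply: eq_from_tnth => i; rewrite tnth_map !tnth_mktuple eval_iso.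
- by rewrite IHF.
- by split=> H k; apply/IHF.
- split=> -[x Hx]; first by exists (h x); rewrite -push_comp -IHF.
  by exists (h' x); rewrite IHF push_comp h'K.
Qed.

End Invariance.

End Isomorphism.

Section Definability.
Variable L : language.

(** Formulas are handled through the predicates they define, uniformly over all countable
    structures, with variables named by a type [X]. Universes are [countType]s so that membership,
    [uniq] and [spine] are booleans there. *)
Definition dpred (X : Type) := forall T : countType, structure L T -> (X -> T) -> Prop.

Lemma formula_rename n m (F : formula L n) (s : 'I_n -> 'I_m) :
  exists G : formula L m, forall (T : Type) (M : structure L T) (e : 'I_m -> T),
    holds M G e <-> holds M F (fun i => e (s i)).
Proof.
have termR k l (u : term L k) (r : 'I_k -> 'I_l) : exists v : term L l,
    forall (T : Type) (M : structure L T) (e : 'I_l -> T),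
      eval M e v = eval M (fun i => e (r i)) u.
  elim: u => [i|f a /choice[b Hb]]; first by exists (Var L (r i)).
  exists (App b) => T M e /=; congr (fun_interp M _).
  by apply: eq_from_tnth => i; rewrite !tnth_mktuple Hb.
elim: F m s => {n} [n u v|n r a|n F IHF|n F IHF|n F IHF] m s.
- have [u' Hu] := termR _ _ u s; have [v' Hv] := termR _ _ v s.
  by exists (Equal u' v') => T M e /=; rewrite Hu Hv.
- have /choice[b Hb] := fun i => termR _ _ (a i) s.
  exists (Rel b) => T M e /=; set t1 := mktuple _; set t2 := mktuple _.
  suff -> : t1 = t2 by [].
  by apply: eq_from_tnth => i; rewrite !tnth_mktuple Hb.
- by have [G HG] := IHF _ s; exists (Not G) => T M e /=; rewrite HG.
- have /choice[G HG] := fun k => IHF k _ s.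
  by exists (And G) => T M e /=; split=> H k; apply/HG.
- pose s' (i : 'I_n.+1) : 'I_m.+1 :=
    if unlift ord0 i is Some j then lift ord0 (s j) else ord0.
  have [G HG] := IHF _ s'; exists (Exists G) => T M e /=.
  have E x : (fun i => push x e (s' i)) = push x (fun i => e (s i)).
    apply: funext => i; rewrite /push /s'; case: (unliftP ord0 i) => [j|] _.
      by rewrite liftK.
    by rewrite unlift_none.
  by split=> -[x Hx]; exists x; move: Hx; rewrite HG E.
Qed.

Definition definable (X : finType) (P : dpred X) : Prop :=
  exists F : formula L #|X|, forall (T : countType) (M : structure L T) (e : X -> T),
    holds M F (fun i => e (enum_val i)) <-> P T M e.

Lemma def_ext (X : finType) (P Q : dpred X) :
  (forall T M e, P T M e <-> Q T M e) -> definable P -> definable Q.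
Proof. by move=> PQ [F HF]; exists F => T M e; rewrite HF. Qed.

Section Connectives.
Variable X : finType.
Implicit Types P Q : dpred X.

Lemma def_const (p : Prop) : definable (fun T M (e : X -> T) => p).
Proof.
have [Hp|Hp] := pselect p.
  by exists (Top _ _) => T M e; split=> // _; exact: holds_Top.
by exists (Not (Top _ _)) => T M e; split=> // H; case: H; exact: holds_Top.
Qed.

Lemma def_not P : definable P -> definable (fun T M e => ~ P T M e).
Proof. by case=> F HF; exists (Not F) => T M e /=; rewrite HF. Qed.

Lemma def_bigand (I : countType) (P : I -> dpred X) :
  (forall i, definable (P i)) -> definable (fun T M e => forall i, P i T M e).
Proof.
move=> /choice[F HF]; exists (And_over F) => T M e.
by rewrite holds_And_over; split=> H i; apply/HF.
Qed.

Lemma def_bigor (I : countType) (P : I -> dpred X) :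
  (forall i, definable (P i)) -> definable (fun T M e => exists i, P i T M e).
Proof.
move=> HP; apply: (@def_ext _ (fun T M e => ~ forall i, ~ P i T M e)).
  by move=> T M e; split=> [/existsNP[i /contrapT]|[i Pi] /(_ i)]; first by exists i.
by apply: def_not; apply: def_bigand => i; exact: def_not.
Qed.

Lemma def_and P Q :
  definable P -> definable Q -> definable (fun T M e => P T M e /\ Q T M e).
Proof.
case=> F HF [G HG]; exists (And2 F G) => T M e.
by rewrite holds_And2 HF HG.
Qed.

Lemma def_imp P Q :
  definable P -> definable Q -> definable (fun T M e => P T M e -> Q T M e).
Proof.
case=> F HF [G HG]; exists (Imp F G) => T M e.
by rewrite holds_Imp HF HG.
Qed.

Lemma def_or P Q :
  definable P -> definable Q -> definable (fun T M e => P T M e \/ Q T M e).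
Proof.
move=> HP HQ; apply: (@def_ext _ (fun T M e => ~ P T M e -> Q T M e)).
  move=> T M e; split=> [H|[HP'|HQ']]//.
  by have [|/H] := pselect (P T M e); [left|right].
by apply: def_imp => //; exact: def_not.
Qed.

Lemma def_iff P Q :
  definable P -> definable Q -> definable (fun T M e => P T M e <-> Q T M e).
Proof. by move=> HP HQ; apply: def_and; apply: def_imp. Qed.

Lemma def_andb (p q : forall T : countType, structure L T -> (X -> T) -> bool) :
  definable (fun T M e => p T M e) -> definable (fun T M e => q T M e) ->
  definable (fun T M e => p T M e && q T M e).
Proof.
move=> Hp Hq; apply: (def_ext _ (def_and Hp Hq)) => T M e.
by split=> [[-> ->]|/andP].
Qed.

Lemma def_negb (p : forall T : countType, structure L T -> (X -> T) -> bool) :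
  definable (fun T M e => p T M e) -> definable (fun T M e => ~~ p T M e).
Proof.
by move=> Hp; apply: (def_ext _ (def_not Hp)) => T M e; split=> /negP.
Qed.

Lemma def_ifb (p q r : forall T : countType, structure L T -> (X -> T) -> bool) :
  definable (fun T M e => p T M e) -> definable (fun T M e => q T M e) ->
  definable (fun T M e => r T M e) ->
  definable (fun T M e => if p T M e then q T M e else r T M e).
Proof.
move=> Hp Hq Hr.
apply: (def_ext _ (def_and (def_imp Hp Hq) (def_imp (def_not Hp) Hr))) => T M e.
case: ifP => pb; split=> [[H1 H2]|H]; [exact: H1|by split|by apply: H2|by split].
Qed.

Lemma def_eq (x y : X) : definable (fun T M e => e x = e y).
Proof.
exists (Equal (Var L (enum_rank x)) (Var L (enum_rank y))) => T M e /=.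
by rewrite !enum_rankK.
Qed.

End Connectives.

(* The premise quantifies over all extensions [g : X -> Y] of the context, so
   that nested quantifiers need no explicit renaming of variables. *)
Lemma def_ex (X : finType) (P : forall T : countType, structure L T -> T -> (X -> T) -> Prop) :
  (forall (Y : finType) (g : X -> Y) (v : Y),
     definable (fun T M (e : Y -> T) => P T M (e v) (fun x => e (g x)))) ->
  definable (fun T M e => exists x, P T M x e).
Proof.
move=> /(_ (option X) Some None)[F HF].
pose s (i : 'I_#|{: option X}|) : 'I_#|X|.+1 :=
  if enum_val i is Some x then lift ord0 (enum_rank x) else ord0.
have [G HG] := formula_rename F s; exists (Exists G) => T M e /=.
have E x : (fun i => push x (fun i : 'I_#|X| => e (enum_val i)) (s i)) =
    (fun i => oapp e x (enum_val i)).
  apply: funext => i; rewrite /s /push; case: (enum_val i) => [y|] /=.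
    by rewrite liftK enum_rankK.
  by rewrite unlift_none.
by split=> -[x Hx]; exists x; move: Hx; rewrite HG E (HF T M (oapp e x)).
Qed.

Lemma def_all (X : finType) (P : forall T : countType, structure L T -> T -> (X -> T) -> Prop) :
  (forall (Y : finType) (g : X -> Y) (v : Y),
     definable (fun T M (e : Y -> T) => P T M (e v) (fun x => e (g x)))) ->
  definable (fun T M e => forall x, P T M x e).
Proof.
move=> HP; apply: (@def_ext _ (fun T M e => ~ exists x, ~ P T M x e)).
  move=> T M e; split=> [H x|H [x]//].
  by apply: contrapT => nP; apply: H; exists x.
by apply/def_not/def_ex => Y g v; cbv beta; apply: def_not; exact: HP.
Qed.

(** Infinitary logic enters here: quantifying over finite sequences is a countable disjunction, over
    the length [n], of blocks of [n] existential quantifiers. *)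
Lemma def_exs (X : finType)
    (P : forall T : countType, structure L T -> seq T -> (X -> T) -> Prop) :
  (forall (Y : finType) (g : X -> Y) (vs : seq Y),
     definable (fun T M (e : Y -> T) => P T M (map e vs) (fun x => e (g x)))) ->
  definable (fun T M e => exists q, P T M q e).
Proof.
have def_exn n : forall (X : finType)
    (P : forall T : countType, structure L T -> seq T -> (X -> T) -> Prop),
  (forall (Y : finType) (g : X -> Y) (vs : seq Y),
     definable (fun T M (e : Y -> T) => P T M (map e vs) (fun x => e (g x)))) ->
  definable (fun T M e => exists2 q, size q = n & P T M q e).
  elim: n => [|n IHn] {}X {}P HP.
    have := HP X id [::]; apply: def_ext => T M e /=; split=> [H|[q]].
      by exists [::].
    by move/size0nil => ->.
  have : definable (fun T M (e : X -> T) => exists x,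
      exists2 q, size q = n & P T M (x :: q) e).
    apply: def_ex => Y g v.
    apply: (IHn Y (fun T M q e => P T M (e v :: q) (fun x => e (g x)))) => Z h vs.
    exact: (HP Z (fun x => h (g x)) (h v :: vs)).
  apply: def_ext => T M e; split=> [[x [q sq Pq]]|[[|x q]//= [sq] Pq]].
    by exists (x :: q) => //=; rewrite sq.
  by exists x, q.
move=> HP; apply: (@def_ext _ (fun T M e => exists n, exists2 q, size q = n & P T M q e)).
  by move=> T M e; split=> [[n [q _ Pq]]|[q Pq]]; [exists q|exists (size q), q].
by apply: def_bigor => n; exact: def_exn.
Qed.

Lemma def_alls (X : finType)
    (P : forall T : countType, structure L T -> seq T -> (X -> T) -> Prop) :
  (forall (Y : finType) (g : X -> Y) (vs : seq Y),
     definable (fun T M (e : Y -> T) => P T M (map e vs) (fun x => e (g x)))) ->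
  definable (fun T M e => forall q, P T M q e).
Proof.
move=> HP; apply: (@def_ext _ (fun T M e => ~ exists q, ~ P T M q e)).
  move=> T M e; split=> [H x|H [x]//].
  by apply: contrapT => nP; apply: H; exists x.
by apply/def_not/def_exs => Y g v; cbv beta; apply: def_not; exact: HP.
Qed.

Lemma def_in (X : finType) (x : X) (vs : seq X) :
  definable (fun T M e => e x \in map e vs).
Proof.
elim: vs => [|v vs IHvs]; first exact: (def_const X false).
apply: (@def_ext _ (fun T M e => e x = e v \/ e x \in map e vs)).
  by move=> T M e /=; rewrite inE; split=> [[->|->]|/predU1P]; rewrite ?eqxx ?orbT.
by apply: def_or => //; exact: def_eq.
Qed.

Lemma def_uniq (X : finType) (vs : seq X) : definable (fun T M e => uniq (map e vs)).
Proof.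
elim: vs => [|v vs IHvs] /=; first exact: def_const.
by apply: def_andb => //; apply: def_negb; exact: def_in.
Qed.

Lemma definable_sentence (P : forall T : countType, structure L T -> Prop) :
  definable (fun T M (e : void -> T) => P T M) ->
  exists F : sentence L, forall (T : countType) (M : structure L T),
    satisfies M F <-> P T M.
Proof.
case=> F HF.
have Ec (i : 'I_#|{: void}|) : False by case: i => i /=; rewrite card_void.
have [G HG] := formula_rename F (fun i => False_rect 'I_0 (Ec i)).
exists G => T M.
pose e (x : void) : T := match x with end.
rewrite -(HF T M e) /satisfies HG; suff -> : (fun i => e (enum_val i)) = 
  (fun i => False_rect T (notF (ltn_ord (False_rect 'I_0 (Ec i))))) by [].
by apply: funext => i; case: (Ec i).
Qed.

End Definability.

(** * Perfect sets of structures *)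

Lemma nbhs_discrete_prod1 (I : countType) (T : choiceType)
    (f : prod_topology (fun _ : I => discrete_topology T)) (i : I) :
  nbhs f [set g | f i = g i].
Proof.
have /cvg_sup/(_ i) : f --> f by exact: cvg_id.
apply; exists [set g | f i = g i]; split=> //.
exists [set f i]; first exact: (@discrete_open (discrete_topology T)).
by rewrite eqEsubset; split=> g /= ->.
Qed.

(** Only finitely many indices have a code below [n], because [pickle] is injective, so such
    agreement is a finite intersection of subbasic open sets; conversely a subbasic open set looks
    at one coordinate only. *)
Lemma nbhs_discrete_prodP (I : countType) (T : choiceType)
    (f : prod_topology (fun _ : I => discrete_topology T))
    (U : set (prod_topology (fun _ : I => discrete_topology T))) :
  nbhs f U <->
  exists n, forall g : prod_topology (fun _ : I => discrete_topology T),
    (forall i, pickle i < n -> f i = g i) -> U g.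
Proof.
pose B n := [set g : prod_topology (fun _ : I => discrete_topology T) |
  forall i, pickle i < n -> f i = g i].
have nf : Filter (nbhs f) by exact: nbhs_filter.
split=> [|[n BU]]; last first.
  apply: (filterS BU); elim: n {BU} => [|n IHn]; first by apply: filterS (@filterT _ (nbhs f) _) => g _ i.
  have : nbhs f [set g | forall i, pickle i = n -> f i = g i].
    have [[i Ei]|Nn] := pselect (exists i : I, pickle i = n); last first.
      by apply: filterS (@filterT _ (nbhs f) _) => g _ i Ei; case: Nn; exists i.
    have := nbhs_discrete_prod1 f i; apply: filterS => g gi j Ej.
    have -> : j = i by apply: (pcan_inj pickleK); rewrite Ej Ei.
    exact: gi.
  move: IHn; apply: filterS2 => g /= H1 H2 i; rewrite ltnS leq_eqVlt.
  by case/predU1P => [/H2|/H1].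
have FB : Filter (filter_from [set: nat] B).
  apply: filter_from_filter; first by exists 0.
  move=> m n _ _; exists (maxn m n) => // g Bg.
  by split=> i lti; apply: Bg; rewrite leq_max lti ?orbT.
suff cB : filter_from [set: nat] B --> f.
  by move/cB => [n _ BU]; exists n => g; exact: BU.
apply/cvg_sup => i V [W] [[X] oX <-] Xf XV.
by exists (pickle i).+1 => // g Bg; apply: XV => /=; rewrite -Bg.
Qed.

Section Agree.
Variables (L : language) (T : countType).
Implicit Types (M N : structure L T) (P Q : set (structure L T)).

(** The structures that agree with [M] up to [n] form a neighbourhood base at [M], so the topology
    can be replaced by this relation. *)
Definition agree n M N : Prop :=
  (forall x, pickle x < n -> M.1 x = N.1 x) /\
  (forall x, pickle x < n -> M.2 x = N.2 x).

Lemma agree_refl n M : agree n M M.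
Proof. by split. Qed.

Lemma agree_sym n M N : agree n M N -> agree n N M.
Proof. by case=> H1 H2; split=> x ltx; rewrite (H1, H2). Qed.

Lemma agree_trans n M N M' : agree n M N -> agree n N M' -> agree n M M'.
Proof.
by case=> H1 H2 [H3 H4]; split=> x ltx; rewrite (H1, H2) // (H3, H4).
Qed.

Lemma agree_leq m n M N : m <= n -> agree n M N -> agree m M N.
Proof.
by move=> lemn [H1 H2]; split=> x ltx; [apply: H1|apply: H2]; exact: leq_trans lemn.
Qed.

Lemma agree_eq M N : (forall n, agree n M N) -> M = N.
Proof.
case: M N => [M1 M2] [N1 N2] H; congr pair; apply: funext => x.
  by have [H1 _] := H (pickle x).+1; exact: H1.
by have [_ H2] := H (pickle x).+1; exact: H2.
Qed.

Lemma nbhs_agreeP (M : structure_space L T) (U : set (structure_space L T)) :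
  nbhs M U <-> exists n, forall N : structure_space L T, agree n M N -> U N.
Proof.
split=> [[[A B] /= [/nbhs_discrete_prodP[m Am] /nbhs_discrete_prodP[n Bn]] ABU]|].
  exists (maxn m n) => N [H1 H2]; apply: ABU; split=> /=.
    by apply: Am => i lti; apply: H1; rewrite leq_max lti.
  by apply: Bn => i lti; apply: H2; rewrite leq_max lti orbT.
case=> n HU; exists ([set g | forall x, pickle x < n -> M.1 x = g x],
                     [set g | forall x, pickle x < n -> M.2 x = g x]).
  by split=> /=; apply/nbhs_discrete_prodP; exists n.
by move=> N [H1 H2]; apply: HU.
Qed.

(** Closedness in terms of [agree]. Together with [splitting], which excludes isolated points, it is
    all that is retained of a perfect set. *)
Definition limit_closed P :=
  forall M, (forall n, exists2 N, P N & agree n M N) -> P M.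

Definition splitting P :=
  forall M n, P M -> exists N, [/\ P N, agree n M N & N <> M].

Lemma perfect_set_limit_closed (P : set (structure_space L T)) :
  perfect_set P -> limit_closed P.
Proof.
case=> cP _ M HM; apply: cP => U /nbhs_agreeP[n HU].
by have [N PN aN] := HM n; exists N; split=> //; exact: HU.
Qed.

Lemma perfect_set_splitting (P : set (structure_space L T)) :
  perfect_set P -> splitting P.
Proof.
case=> _ lP M n PM; have : limit_point P M by rewrite lP.
have nM : nbhs (M : structure_space L T) [set N | agree n M N].
  by apply/nbhs_agreeP; exists n.
by move/(_ _ nM) => [N [/eqP NM PN aN]]; exists N.
Qed.

Lemma agree_lim (t : nat -> structure L T) (l : nat -> nat) :
  (forall k, k <= l k) -> (forall k, l k <= l k.+1) ->
  (forall k, agree (l k) (t k) (t k.+1)) ->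
  exists M, forall k, agree (l k) (t k) M.
Proof.
move=> lek lmon at_.
have lm j k : j <= k -> l j <= l k.
  elim: k => [|k IHk]; first by rewrite leqn0 => /eqP ->.
  rewrite leq_eqVlt => /predU1P[->//|/IHk H]; exact: leq_trans (lmon k).
have stab j k : j <= k -> agree (l j) (t j) (t k).
  elim: k => [|k IHk]; first by rewrite leqn0 => /eqP ->; exact: agree_refl.
  rewrite leq_eqVlt => /predU1P[->|]; first exact: agree_refl.
  rewrite ltnS => lejk; apply: agree_trans (IHk lejk) _.
  exact: agree_leq (lm _ _ lejk) (at_ k).
(* At stage [(pickle x).+1] the value at [x] is final, because the level is at least the stage. *)
exists (fun x => (t (pickle x).+1).1 x, fun x => (t (pickle x).+1).2 x) => k.
split=> x ltx /=.
  have [lek'|ltk] := leqP k (pickle x).+1; first exact: (stab _ _ lek').1.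
  by rewrite (stab _ _ (ltnW ltk)).1.
have [lek'|ltk] := leqP k (pickle x).+1; first exact: (stab _ _ lek').2.
by rewrite (stab _ _ (ltnW ltk)).2.
Qed.

(* The Cantor scheme: at stage [k] the bit [a k] decides whether to stay at the
   current structure or to move to one that agrees with it up to the current
   level but differs from it before the next level. *)
Lemma cantor_scheme P : P !=set0 -> limit_closed P -> splitting P ->
  exists f : (nat -> bool) -> structure L T,
    [/\ forall a, P (f a),
        forall n a b, (forall i, i < n -> a i = b i) -> agree n (f a) (f b) &
        injective f].
Proof.
move=> [M0 PM0] clP spP.
have /choice[s Hs] : forall tn : structure L T * nat, exists um : structure L T * nat,
    P tn.1 -> [/\ P um.1, agree tn.2 tn.1 um.1, ~ agree um.2 tn.1 um.1 & tn.2 < um.2].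
  case=> t n /=; have [Pt|nPt] := pselect (P t); last by exists (t, n).
  have [u [Pu au ne]] := spP t n Pt.
  have [m nm] : exists m, ~ agree m t u.
    by apply: contrapT => /forallNP H; apply: ne; apply/esym/agree_eq => m;
       apply: contrapT.
  exists (u, m) => _; split=> //=; rewrite ltnNge; apply/negP => lemn.
  by apply: nm; exact: agree_leq lemn au.
(* Both branches pass to the new level [um.2], at which the old structure and the new one are
   already told apart. *)
pose st := fix st (a : nat -> bool) k := if k is k'.+1 then
  let um := s (st a k') in (if a k' then um.1 else (st a k').1, um.2) else (M0, 0).
have Pst a k : P (st a k).1.
  by elim: k => //= k IHk; case: (a k) => //; have [] := Hs _ IHk.
have lst a k : (st a k).2 < (st a k.+1).2 by have [] := Hs _ (Pst a k).
have lek a k : k <= (st a k).2.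
  by elim: k => // k IHk; exact: leq_ltn_trans IHk (lst a k).
have ast a k : agree (st a k).2 (st a k).1 (st a k.+1).1.
  by rewrite /=; case: (a k); [case: (Hs _ (Pst a k))|exact: agree_refl].
have /choice[f Hf] : forall a, exists M, forall k, agree (st a k).2 (st a k).1 M.
  by move=> a; apply: agree_lim => // k; exact: ltnW.
have st_eq a b k : (forall i, i < k -> a i = b i) -> st a k = st b k.
  elim: k => //= k IHk H; rewrite IHk ?H // => i ltik; exact/H/ltnW.
exists f; split.
- move=> a; apply: clP => n; exists (st a n).1; first exact: Pst.
  by apply/agree_sym; apply: agree_leq (lek a n) (Hf a n).
- move=> n a b /st_eq Eab; apply: agree_leq (lek a n) _.
  by apply: agree_trans (agree_sym (Hf a n)) _; rewrite Eab.
- move=> a b Eab; apply: contrapT => ne.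
  (* Up to the first bit where [a] and [b] differ the stages coincide. The next stages are separated
     by the new level, yet a common limit would agree with both up to it. *)
  have /ex_minnP[k /eqP nk mink] : exists k, a k != b k.
    apply: contrapT => /forallNP H; apply: ne; apply: funext => k.
    by apply/eqP; apply: contrapT => /negP; exact: H.
  have E : st a k = st b k.
    apply: st_eq => i ltik; apply/eqP; apply: contrapT => /negP /mink.
    by rewrite leqNgt ltik.
  have [_ _ nag _] := Hs _ (Pst a k); apply: nag.
  have := Hf a k.+1; have := Hf b k.+1; rewrite /= -E -Eab.
  case: (a k) (b k) nk => [] [] //= _ H1 H2.
    exact: agree_trans H1 (agree_sym H2).
  exact: agree_trans H2 (agree_sym H1).
Qed.

(** The Baire category theorem: otherwise every ball around a point of [P] contains a smaller one,
    again around a point of [P], that avoids [C n]; doing this for all [n] in turn gives a limit in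
    [P] outside every [C n]. *)
Lemma limit_closed_baire P (C : nat -> set (structure L T)) :
  P !=set0 -> limit_closed P -> (forall n, limit_closed (C n)) ->
  P `<=` \bigcup_n C n ->
  exists n m M, P M /\ forall N, P N -> agree m M N -> C n N.
Proof.
move=> [M0 PM0] clP clC cov; apply: contrapT => H.
have step n tm : exists um : structure L T * nat, P tm.1 ->
    [/\ P um.1, agree tm.2 tm.1 um.1, tm.2 < um.2 &
        forall N, agree um.2 um.1 N -> ~ C n N].
  case: tm => t m /=; have [Pt|nPt] := pselect (P t); last by exists (t, m).
  have [u [Pu au nCu]] : exists u, [/\ P u, agree m t u & ~ C n u].
    apply: contrapT => /forallNP nex; apply: H; exists n, m, t; split=> // N PN aN.
    by apply: contrapT => nC; apply: (nex N).
  have [l Hl] : exists l, forall N, agree l u N -> ~ C n N.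
    apply: contrapT => /forallNP nl; apply: nCu; apply: clC => l.
    have /existsNP[N /not_implyP[aN /contrapT CN]] := nl l.
    by exists N.
  (* Taking at least [m.+1] makes the levels grow, so that the stages have a limit. *)
  exists (u, maxn l m.+1) => _; split=> //=; first by rewrite leq_max leqnn orbT.
  by move=> N aN; apply: Hl; apply: agree_leq aN; exact: leq_maxl.
have /choice[s Hs] : forall x, exists um : structure L T * nat, P x.2.1 ->
    [/\ P um.1, agree x.2.2 x.2.1 um.1, x.2.2 < um.2 &
        forall N, agree um.2 um.1 N -> ~ C x.1 N].
  by move=> [n tm]; exact: step.
pose st := fix st k := if k is k'.+1 then s (k', st k') else (M0, 0).
have Pst k : P (st k).1 by elim: k => //= k IHk; have [] := Hs (k, st k) IHk.
have lst k : (st k).2 < (st k.+1).2 by have [] := Hs (k, st k) (Pst k).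
have lek k : k <= (st k).2.
  by elim: k => // k IHk; exact: leq_ltn_trans IHk (lst k).
have [|k|M HM] := @agree_lim (fun k => (st k).1) (fun k => (st k).2) lek.
- by move=> k; exact: ltnW.
- by have [] := Hs (k, st k) (Pst k).
have PM : P M.
  apply: clP => n; exists (st n).1; first exact: Pst.
  by apply/agree_sym; apply: agree_leq (lek n) (HM n).
have [n _ CM] := cov _ PM.
have [_ _ _ nC] := Hs (n, st n) (Pst n).
exact: (nC M (HM n.+1)).
Qed.

End Agree.

(** The image of the Cantor space under a continuous injection is compact, hence closed in this
    Hausdorff space, and has no isolated point because flipping a late bit moves a structure only
    slightly. *)
Lemma cantor_perfectly_many (L : language) (T : countType) (phi : sentence L)
    (g : (nat -> bool) -> structure L T) : inhabited T ->
  (forall a, satisfies (g a) phi) ->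
  (forall a b, isomorphic (g a) (g b) -> a = b) ->
  (forall a n, exists m, forall b, (forall i, i < m -> a i = b i) ->
    agree n (g a) (g b)) ->
  perfectly_many_models phi.
Proof.
move=> iT gphi giso gcont.
have refl (M : structure L T) : isomorphic M M.
  exists id; split; first by exists id.
    by move=> f t; congr (fun_interp M _); apply: eq_from_tnth => i; rewrite tnth_map.
  by move=> r t; congr (rel_interp M _); apply: eq_from_tnth => i; rewrite tnth_map.
have ginj : injective g by move=> a b E; apply: giso; rewrite E.
pose h : cantor_space -> structure_space L T := g.
have hcont : continuous h.
  move=> a U /= /nbhs_agreeP[n HU]; have [m Hm] := gcont a n.
  have /(_ a) H := nbhs_discrete_prodP (I := nat) (T := bool).
  have : nbhs (a : cantor_space) [set b | forall i, i < m -> a i = b i].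
    by apply/H; exists m => b Hb i lti; exact: Hb.
  by apply: filterS => b /= /Hm; exact: HU.
exists T, (range h); split=> //.
- by exists (h (fun=> true)), (fun=> true).
- have cl : closed (range h).
    apply: compact_closed => [M N cMN|].
      apply: agree_eq => n.
      have nM : nbhs (M : structure_space L T) [set M' | agree n M M'].
        by apply/nbhs_agreeP; exists n.
      have nN : nbhs (N : structure_space L T) [set M' | agree n N M'].
        by apply/nbhs_agreeP; exists n.
      have [M' [H1 H2]] := cMN _ _ nM nN.
      exact: agree_trans H1 (agree_sym H2).
    apply: continuous_compact; last exact: cantor_space_compact.
    exact: continuous_subspaceT.
  split=> //; rewrite eqEsubset; split=> M.
    by move=> lM; apply: cl; exact: subset_limit_point.
  case=> a _ <- U /nbhs_agreeP[n HU].
  have [m Hm] := gcont a n.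
  pose b i := if i == m then ~~ a i else a i.
  exists (h b); split; last 1 first.
  - apply: HU; apply: Hm => i; rewrite /b; by case: ltngtP.
  - apply/eqP => /ginj/(congr1 (fun c => c m)); rewrite /b eqxx; by case: (a m).
  - by exists b.
- by move=> M [a _ <-]; exact: gphi.
- by move=> M N [a _ <-] [b _ <-] /giso ->.
Qed.

(** * Word trees *)

Section Words.

(** When [p] recognises the letter None, these are the words None^m c, stored newest letter first.
    The predicate stays abstract because in a tree the letter None is recognised as equivalence with
    the root. *)
Fixpoint body (A : Type) (p : pred A) (w : seq A) : bool :=
  if w is l :: w' then (if p l then all p w' else body p w') else true.

Definition marked (A : Type) (p : pred A) (w : seq A) : bool :=
  if w is l :: k :: w' then [&& p l, ~~ p k & body p w'] else false.

Lemma body_map (A B : Type) (p : pred A) (p' : pred B) (f : B -> A) w :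
  (forall x, p (f x) = p' x) -> body p (map f w) = body p' w.
Proof.
move=> E; elim: w => //= x w ->; rewrite E all_map; case: (p' x) => //.
exact: eq_all.
Qed.

Lemma marked_map (A B : Type) (p : pred A) (p' : pred B) (f : B -> A) w :
  (forall x, p (f x) = p' x) -> marked p (map f w) = marked p' w.
Proof. by move=> E; case: w => [|x [|y w]] //=; rewrite !E (body_map _ E). Qed.

Variable A : countType.
Implicit Type w : seq (option A).

Definition none (l : option A) : bool := ~~ isSome l.

Lemma body_cat (s : seq A) m : body none (map Some s ++ nseq m None).
Proof. by elim: s => [|a s IHs] //=; case: m => //= m; rewrite all_nseq orbT. Qed.

Lemma bodyP w : body none w ->
  w = map Some (pmap id w) ++ nseq (count none w) None.
Proof.
elim: w => [|[a|] w IHw] //= Hw; first by rewrite [in LHS]IHw.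
have E : w = nseq (size w) None by apply/all_pred1P; apply: sub_all Hw => -[].
have -> : pmap id w = [::] by rewrite E; elim: (size w).
rewrite /=; congr cons; rewrite {1}E; congr nseq.
by apply/esym/eqP; rewrite -all_count.
Qed.

Variable F : nat -> A -> seq A -> bool.

(* Words are stored newest letter first.  The legal ones are [None^m] followed
   by letters of [A]; a final [None] after a nonempty string over [A] records
   that [F] holds there. *)
Definition wf (w : seq (option A)) : bool :=
  if w is None :: Some a :: w' then
    body none w' && F (count none w') a (pmap id w')
  else body none w.

Lemma body_wf w : body none w -> wf w.
Proof. by case: w => [|[a|] [|[b|] w]]. Qed.

Lemma wf_body w : wf w -> body none w || marked none w.
Proof.
by case: w => [|[a|] [|[b|] w]] //= Hw; rewrite ?Hw //; case/andP: Hw => ->.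
Qed.

Lemma wf_mark m a s : wf (None :: Some a :: map Some s ++ nseq m None) = F m a s.
Proof.
rewrite /= body_cat /=; congr F.
  by rewrite count_cat count_map count_pred0 count_nseq /= mul1n.
by rewrite pmap_cat [X in X ++ _](_ : _ = s) ?[X in _ ++ X](_ : _ = [::]) ?cats0 //;
  [elim: m|elim: s => //= b s ->].
Qed.

Lemma wf_behead l w : wf (l :: w) -> wf w.
Proof.
case: l w => [a|] [|[b|] w] //=.
- by move=> H; apply: (@body_wf (None :: w)).
- by case/andP.
- by move=> H; apply: (@body_wf (None :: w)).
Qed.

End Words.

Arguments adj : simpl never.
Arguments order_rel : simpl never.

(** * Words read off from the paths of a tree *)

Section Spines.
Variables (C : countType) (T : countType) (t : structure (tree_language C) T).
Local Notation adj := (adj t).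
Local Notation ord := (order_rel t).

(* Self-avoiding paths from [r], last vertex first. *)
Fixpoint spine (r : T) (q : seq T) : bool :=
  if q is x :: q' then [&& adj (head r q') x, x \notin r :: q' & spine r q']
  else true.

(** In a word tree the class of a vertex is its newest letter, so this expresses that the word
    spelled by the classes of [u] occurs as a vertex. *)
Definition reach r u : Prop := exists2 q, spine r q & all2 ord q u.

(** Presence of the mark of the [m]-th fact at [a :: s]: [r] stands for the letter None, [nseq m r]
    selects the fact, and the leading [r] is the mark itself. *)
Definition fact r m a s : Prop := reach r (r :: a :: s ++ nseq m r).

Definition elem r x : bool := adj r x && ~~ ord x r.

(** Vertices correspond to self-avoiding paths from the root, and adjacency to extension by one
    vertex; by the last clause such a path is determined by the classes along it. *)
Definition tree_axioms r : Prop :=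
  [/\ forall c (v : 0.-tuple T), @fun_interp (tree_language C) T t c v = r,
      forall x, exists2 q, spine r q & head r q = x,
      forall q q', spine r q -> spine r q' -> head r q = head r q' -> q = q',
      forall q q', spine r q -> spine r q' -> adj (head r q) (head r q') ->
        q != [::] /\ behead q = q' \/ q' != [::] /\ behead q' = q &
      forall q q', spine r q -> spine r q' -> all2 ord q q' -> q = q'].

Definition word_axioms r : Prop :=
  [/\ exists a, ~~ ord a r,
      forall u, body (ord^~ r) u -> reach r u &
      forall q, spine r q -> body (ord^~ r) q || marked (ord^~ r) q].

End Spines.

Section WordTree.
Variables (C A : countType) (F : nat -> A -> seq A -> bool).

Definition vtx : Type := {w : seq (option A) | wf F w}.
HB.instance Definition _ := Countable.on vtx.

Definition vroot : vtx := exist (fun w => wf F w) [::] isT.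
Definition vemb (a : A) : vtx := exist (fun w => wf F w) [:: Some a] isT.

Definition child (u v : seq (option A)) : bool :=
  if v is _ :: v' then v' == u else false.

(** The default in [head None] puts the root, the empty word, into the class of the letter None. All
    constants name the root, so one coding serves rooted and unrooted trees. *)
Definition wtree : structure (tree_language C) vtx :=
  (fun=> vroot,
   fun x : {r : bool & 2.-tuple vtx} =>
     let u := val (tnth (tagged x) ord0) in
     let v := val (tnth (tagged x) ord_max) in
     if tag x then child u v || child v u else head None u == head None v).

Local Notation adj := (adj wtree).
Local Notation ord := (order_rel wtree).
Definition cls (v : vtx) : option A := head None (val v).

Lemma wadjE u v : adj u v = child (val u) (val v) || child (val v) (val u).
Proof. by []. Qed.

Lemma wordE u v : ord u v = (cls u == cls v).
Proof. by []. Qed.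

Lemma child_size u v : child u v -> size v = (size u).+1.
Proof. by case: v => //= l v /eqP ->. Qed.

Lemma wtree_is_tree : is_tree adj.
Proof.
have sy : symmetric adj by move=> u v; rewrite !wadjE orbC.
split=> //.
- move=> u; apply/negP; rewrite wadjE orbb => /child_size /eqP.
  by rewrite eqn_leq ltnn andbF.
- have up w (Hw : wf F w) : let v : vtx := exist (fun w => wf F w) w Hw in
      (exists p, path adj v p /\ last v p = vroot) /\
      (exists p, path adj vroot p /\ last vroot p = v).
    elim: w Hw => [|l w IHw] Hw v.
      have -> : v = vroot by exact: val_inj.
      by split; exists [::].
    have [[p [pp lp]] [q [pq lq]]] := IHw (wf_behead Hw).
    set v' : vtx := exist _ w _ in pp lp lq.
    have vv' : adj v v' by rewrite wadjE /= eqxx orbT.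
    split; first by exists (v' :: p); split=> //; exact/andP.
    by exists (rcons q v); rewrite rcons_path last_rcons pq lq sy; split.
  move=> [x Hx] [y Hy]; have [[p [pp lp]] _] := up x Hx.
  have [_ [q [pq lq]]] := up y Hy.
  by exists (p ++ q); rewrite cat_path last_cat lp pp.
- move=> n c ic Hc.
  (* Adjacent words differ by one letter, so both neighbours of a longest word on a cycle are its
     parent. Injectivity then gives [ordS i = ord_pred i], which fails for at least three
     vertices. *)
  case: (@arg_maxnP _ ord0 predT (fun i => size (val (c i)))) => // i _ Hi.
  have par j : adj (c i) (c j) -> val (c j) = behead (val (c i)).
    rewrite wadjE => /orP[/child_size E|].
      by have := Hi j isT; rewrite /= E ltnn.
    by case: (val (c i)) => //= l v /eqP.
  have E : ordS i = ord_pred i.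
    have Hp : adj (c i) (c (ord_pred i)).
      by rewrite sy; have := Hc (ord_pred i); rewrite ord_predK.
    by apply: ic; apply: val_inj; rewrite (par _ (Hc i)) (par _ Hp).
  have : val (ordS (ordS i)) = val i by rewrite E ord_predK.
  move=> /= E2; have : i.+2 = i %[mod n.+3].
    have <- : (i.+1 %% n.+3).+1 %% n.+3 = i.+2 %% n.+3.
      by rewrite -addn1 modnDml addn1.
    by rewrite E2 modn_small.
  move/eqP; rewrite -[X in _ == X %[mod _]]addn0 -addn2 eqn_modDl.
  by rewrite mod0n modn_small.
Qed.

Lemma wtree_equivalence : [/\ reflexive ord, symmetric ord & transitive ord].
Proof.
split=> [x|x y|y x z]; rewrite !wordE; [exact: eqxx|exact: eq_sym|].
by move=> /eqP -> /eqP ->.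
Qed.

Fixpoint tails (w : seq (option A)) :=
  if w is _ :: w' then w :: tails w' else [::].

Lemma map_head_tails w : map (head None) (tails w) = w.
Proof. by elim: w => //= l w ->. Qed.

Lemma mem_tails l w : w \in [::] :: tails (l :: w).
Proof. by case: w => [|k w]; rewrite !inE ?eqxx ?orbT. Qed.

(** The parent of the last vertex already lies on the path or is the root, so a self-avoiding path
    can only add letters; it passes exactly through the nonempty suffixes of its end. *)
Lemma spine_tails q : spine wtree vroot q -> map val q = tails (val (head vroot q)).
Proof.
elim: q => // x q IHq /and3P[axq xq /IHq Eq].
rewrite map_cons Eq -[head vroot (x :: q)]/x; move: axq; rewrite wadjE => /orP[].
  by case: (val x) => // l w /eqP ->.
case E : (val (head vroot q)) => [|l w] // /eqP Ew; case/negP: xq.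
rewrite -(mem_map val_inj) map_cons Eq E.
by have := mem_tails l w; rewrite {1}Ew.
Qed.

Lemma spine_ex v : exists2 q, spine wtree vroot q & head vroot q = v.
Proof.
case: v => w; elim: w => [|l w IHw] Hw.
  by exists [::] => //; exact: val_inj.
have [q sq hq] := IHw (wf_behead Hw).
exists (exist (fun w => wf F w) _ Hw :: q) => //=; rewrite sq hq wadjE /= eqxx /= andbT.
rewrite -(mem_map val_inj) /= (spine_tails sq) hq /= inE /=.
have : forall s, size s < size (l :: w) -> (l :: w) \notin tails s.
  elim=> //= k s IHs lts; rewrite inE negb_or IHs ?andbT; last exact: ltnW.
  by apply: contraTneq lts => -[_ <-]; rewrite ltnn.
by apply.
Qed.

Lemma spine_cls q : spine wtree vroot q -> map cls q = val (head vroot q).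
Proof. by move/spine_tails => E; rewrite -[RHS]map_head_tails -E -map_comp. Qed.

Lemma all2_ord q u : all2 ord q u = (map cls q == map cls u).
Proof. by elim: q u => [|x q IHq] [|y u] //=; rewrite IHq eqseq_cons wordE. Qed.

Lemma reachE u : reach wtree vroot u <-> wf F (map cls u).
Proof.
split=> [[q sq]|Hu]; rewrite ?all2_ord.
  by move/eqP <-; rewrite spine_cls //; case: (head vroot q).
have [q sq hq] := spine_ex (exist (fun w => wf F w) _ Hu).
by exists q => //; rewrite all2_ord spine_cls // hq.
Qed.

Lemma ord_root x : ord x vroot = none (cls x).
Proof. by rewrite wordE /=; case: (cls x). Qed.

Lemma wtree_axioms : tree_axioms wtree vroot.
Proof.
have head_inj q q' : spine wtree vroot q -> spine wtree vroot q' ->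
    val (head vroot q) = val (head vroot q') -> q = q'.
  move=> /spine_tails Eq /spine_tails Eq' E; apply: (inj_map val_inj).
  by rewrite Eq Eq' E.
split=> //; first exact: spine_ex.
- by move=> q q' sq sq' E; apply: head_inj => //; rewrite E.
- have half q q' : spine wtree vroot q -> spine wtree vroot q' ->
      child (val (head vroot q')) (val (head vroot q)) -> q != [::] /\ behead q = q'.
    move=> /spine_tails + /spine_tails E'; case: q => [//|x q].
    move=> /(congr1 behead) Eq Hc; split=> //; apply: (inj_map val_inj).
    by rewrite E' [LHS]Eq; move: Hc; rewrite /=; case: (sval x) => //= l w /eqP ->.
  move=> q q' sq sq'; rewrite wadjE => /orP[] H; [right|left]; exact: half.
- move=> q q' sq sq'; rewrite all2_ord => /eqP E; apply: head_inj => //.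
  by rewrite -!spine_cls.
Qed.

Lemma wtree_words : inhabited A -> word_axioms wtree vroot.
Proof.
case=> a; split; first by exists (vemb a).
- by move=> u Hu; apply/reachE/body_wf; rewrite (body_map _ (fun x => esym (ord_root x))).
- move=> q sq; have : reach wtree vroot q by exists q; rewrite // all2_ord.
  move/reachE/wf_body.
  by rewrite !(body_map _ (fun x => esym (ord_root x)), marked_map _ (fun x => esym (ord_root x))).
Qed.

Lemma fact_vemb m a s : fact wtree vroot m (vemb a) (map vemb s) <-> F m a s.
Proof.
rewrite /fact reachE /= map_cat -map_comp map_nseq -(@wf_mark _ F m a s) /=.
by rewrite [map (cls \o vemb) s](_ : _ = map Some s) //; elim: s => //= b s ->.
Qed.

Lemma elem_vemb v : elem wtree vroot v <-> exists a, v = vemb a.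
Proof.
split=> [/andP[]|[a ->]//]; rewrite ord_root wadjE /cls /=.
case: v => -[|[a|] [|l w]] Hw //= _ _; exists a; exact: val_inj.
Qed.

Lemma all_elem_vemb s : all (elem wtree vroot) s -> exists s', s = map vemb s'.
Proof.
elim: s => [|x s IHs] /=; first by exists [::].
by case/andP => /elem_vemb[a ->] /IHs[s' ->]; exists (a :: s').
Qed.

Lemma all_elem_map s : all (elem wtree vroot) (map vemb s).
Proof. by rewrite all_map; apply/allP => a _; apply/elem_vemb; exists a. Qed.

End WordTree.

Section Transfer.
Variables (C T U : countType).
Variables (t : structure (tree_language C) T) (u : structure (tree_language C) U).
Variable h : T -> U.
Hypothesis ih : is_iso t u h.

Lemma adj_iso x y : adj u (h x) (h y) = adj t x y.
Proof.
have [_ _ hr] := ih; rewrite /adj (hr true); congr (rel_interp u _).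
by apply: eq_from_tnth => i; rewrite tnth_map; case: i => [[|[|]]].
Qed.

Lemma order_iso x y : order_rel u (h x) (h y) = order_rel t x y.
Proof.
have [_ _ hr] := ih; rewrite /order_rel (hr false); congr (rel_interp u _).
by apply: eq_from_tnth => i; rewrite tnth_map; case: i => [[|[|]]].
Qed.

Lemma spine_iso r q : spine u (h r) (map h q) = spine t r q.
Proof.
have [bh _ _] := ih.
elim: q => //= x q ->; rewrite -[h r :: _]/(map h (r :: q)) mem_map; last exact: bij_inj.
by rewrite -adj_iso; case: q.
Qed.

Lemma reach_iso r v : reach t r v <-> reach u (h r) (map h v).
Proof.
have [[h' hK h'K] _ _] := ih; split=> -[q sq Hq].
  exists (map h q); rewrite ?spine_iso //.
  by elim: q v {sq} Hq => [|x q IHq] [|y v] //= /andP[xy /IHq ->]; rewrite order_iso xy.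
have Eq : q = map h (map h' q) by rewrite -map_comp map_id_in // => x _ /=; rewrite h'K.
exists (map h' q); first by rewrite -spine_iso -Eq.
move: Hq; rewrite {1}Eq; elim: (map h' q) v => [|x p IHp] [|y v] //= /andP[xy /IHp ->].
by rewrite -order_iso xy.
Qed.

Lemma fact_iso r m a s : fact t r m a s <-> fact u (h r) m (h a) (map h s).
Proof. by rewrite /fact reach_iso /= map_cat map_nseq. Qed.

Lemma elem_iso r x : elem u (h r) (h x) = elem t r x.
Proof. by rewrite /elem adj_iso order_iso. Qed.

End Transfer.

(** * Reconstruction of a word tree from the axioms *)

Section Reconstruction.
Variables (C T A : countType) (t : structure (tree_language C) T) (r : T).
Variable e : A -> T.
Local Notation adj := (adj t).
Local Notation ord := (order_rel t).
Hypothesis adjC : symmetric adj.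
Hypotheses (ordR : reflexive ord) (ordC : symmetric ord) (ordT : transitive ord).
Hypotheses (treeA : tree_axioms t r) (wordA : word_axioms t r).
Hypothesis e_inj : injective e.
Hypothesis eE : forall x, elem t r x <-> exists a, e a = x.

Let F m a s : bool := `[< fact t r m (e a) (map e s) >].

(** The axioms force a word tree. The letter of a vertex is given by its class: None for the class
    of the root, [a] for the class of [e a]. The words spelled by paths are then exactly the legal
    ones, and sending a word to the end of the path that spells it is an isomorphism. *)
Lemma wtree_reconstruct :
  exists2 h : vtx F -> T, is_iso (wtree C F) t h &
    h (vroot F) = r /\ forall a, h (vemb F a) = e a.
Proof.
have [constE sp_ex sp_head sp_adj sp_ord] := treeA.
have [_ body_reach spine_words] := wordA.
have e_nr a : ~~ ord (e a) r by have /andP[] : elem t r (e a) by apply/eE; exists a.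
have e_adj a : adj r (e a) by have /andP[] : elem t r (e a) by apply/eE; exists a.
have e_spine a : spine t r [:: e a].
  rewrite /= e_adj mem_seq1 andbT /=; apply: contraNneq (e_nr a) => ->; exact: ordR.
have e_ord a b : ord (e a) (e b) -> a = b.
  move=> H; apply: e_inj; suff [] : [:: e a] = [:: e b] by [].
  by apply: sp_ord; rewrite ?e_spine //= H.
have /choice[lt Hlt] : forall x, exists l,
    if l is Some a then ~~ ord x r && ord x (e a) else ord x r.
  move=> x; have [|nxr] := boolP (ord x r); first by exists None.
  (* The one-letter word [[:: x]] is realised by a child of the root, which is an element in the
     class of [x]. *)
  have /body_reach[[|y [|z q]] //=] : body (ord^~ r) [:: x] by rewrite /= (negPf nxr).
    rewrite !andbT => /andP[ry _] yx.
    have /eE[a Ea] : elem t r y.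
      by rewrite /elem ry; apply: contra nxr; apply: ordT; rewrite ordC.
    by exists (Some a) => /=; rewrite Ea ordC.
  by rewrite andbF.
have ltN x : none (lt x) = ord x r.
  by have := Hlt x; case: (lt x) => [a /andP[/negPf->]|->].
have lt_r : lt r = None by have := ltN r; rewrite ordR; case: (lt r).
have ltP x y : lt x = lt y <-> ord x y.
  have := Hlt x; have := Hlt y.
  case Ex : (lt x) => [a|]; case Ey : (lt y) => [b|].
  - move=> /andP[ny yb] /andP[nx xa]; split=> [[E]|xy].
      by apply: ordT xa _; rewrite E ordC.
    congr Some; apply: e_ord; apply: ordT (ordT _ xy) yb; by rewrite ordC.
  - move=> yr /andP[nx _]; split=> // xy; case/negP: nx; exact: ordT xy yr.
  - move=> /andP[ny _] xr; split=> // xy; case/negP: ny; apply: ordT xr.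
    by rewrite ordC.
  - move=> yr xr; split=> // _; apply: ordT xr _; by rewrite ordC.
have lt_e a : lt (e a) = Some a.
  have := Hlt (e a); case: (lt (e a)) => [b /andP[_ /e_ord ->]//|].
  by rewrite (negPf (e_nr a)).
have all2P q u : all2 ord q u <-> map lt q = map lt u.
  elim: q u => [|x q IHq] [|y u] //=; split.
    by move=> /andP[/ltP -> /IHq ->].
  by case=> /ltP -> /IHq ->.
pose rep l := if l is Some a then e a else r.
have lt_rep w : map lt (map rep w) = w.
  by rewrite -map_comp map_id_in // => -[a|] _ /=; rewrite ?lt_e.
have bodyE q : body (@none A) (map lt q) = body (ord^~ r) q by exact: body_map.
have markE q : marked (@none A) (map lt q) = marked (ord^~ r) q by exact: marked_map.
have factE m a s : F m a s <-> exists2 q, spine t r q &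
    map lt q = None :: Some a :: map Some s ++ nseq m None.
  rewrite /F; split=> [/asboolP[q sq /all2P Eq]|[q sq Eq]].
    exists q => //; rewrite Eq /= lt_r lt_e map_cat map_nseq lt_r -map_comp.
    by congr [:: _, _ & _ ++ _]; apply: eq_map.
  apply/asboolP; exists q => //; apply/all2P.
  rewrite Eq /= lt_r lt_e map_cat map_nseq lt_r -map_comp.
  by congr [:: _, _ & _ ++ _]; apply: eq_map => b; rewrite /= lt_e.
have wfE w : wf F w <-> exists2 q, spine t r q & map lt q = w.
  split=> [Hw|[q sq <-]].
    have [Hb|nb] := boolP (body (@none A) w).
      have /body_reach[q sq /all2P Eq] : body (ord^~ r) (map rep w).
        by rewrite -bodyE lt_rep.
      by exists q; rewrite // Eq lt_rep.
    move: Hw nb; case: w => [|[a|] [|[b|] w]] //=; try by move=> ->.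
    by case/andP=> /bodyP Ew /factE[q sq Eq] _; exists q => //; rewrite Eq -Ew.
  case/orP: (spine_words _ sq); rewrite -?bodyE -?markE; first exact: body_wf.
  case Eq : (map lt q) => [|[b|] [|[a|] w']] //= Hb; rewrite Hb /=.
  by apply/factE; exists q; rewrite // Eq -(bodyP Hb).
(* [qq v] is the path that spells the word [v], and [sp x] the path that ends at the vertex [x]; the
   inverse maps [h] and [k] are read off from them. *)
have /choice[qq Hqq] : forall v : vtx F, exists q, spine t r q /\ map lt q = val v.
  by case=> w Hw /=; have /wfE[q sq Eq] := Hw; exists q.
have /choice[sp Hsp] : forall x, exists q, spine t r q /\ head r q = x.
  by move=> x; have [q sq hq] := sp_ex x; exists q.
have wfsp x : wf F (map lt (sp x)) by apply/wfE; exists (sp x); case: (Hsp x).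
have lt_inj q q' : spine t r q -> spine t r q' -> map lt q = map lt q' -> q = q'.
  by move=> sq sq' E; apply: sp_ord => //; apply/all2P.
pose h v := head r (qq v).
pose k x : vtx F := exist (fun w => wf F w) (map lt (sp x)) (wfsp x).
have hK : cancel h k.
  move=> v; apply: val_inj => /=; have [sq <-] := Hqq v; congr map.
  by have [s1 h1] := Hsp (h v); exact: sp_head.
have kK : cancel k h.
  move=> x; rewrite /h; have [sq Eq] := Hqq (k x); have [s1 h1] := Hsp x.
  by rewrite (lt_inj _ _ sq s1 Eq).
have h_root : h (vroot F) = r.
  by rewrite /h; have [_] := Hqq (vroot F); case: (qq _).
exists h; last first.
  split=> // a; rewrite /h; have [sq Eq] := Hqq (vemb F a).
  by rewrite (lt_inj _ _ sq (e_spine a)) //= lt_e.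
split; first by exists k.
  by move=> c v; rewrite constE -h_root.
have half u v : child (val u) (val v) -> adj (h u) (h v).
  have [sv Ev] := Hqq v; have [su Eu] := Hqq u; rewrite /h -Ev -Eu.
  case: (qq v) sv => //= x q /and3P[axq _ sq] /eqP E.
  by rewrite -(lt_inj _ _ sq su E).
have half' u v : qq u != [::] /\ behead (qq u) = qq v -> child (val v) (val u).
  have [_ <-] := Hqq v; have [_ <-] := Hqq u.
  by case: (qq u) => [[]|x q [_ /= ->]].
have headE v : head None (val v) = lt (h v).
  by have [_ <-] := Hqq v; rewrite /h; case: (qq v) => //=; rewrite lt_r.
move=> b v.
have -> : map_tuple h v = [tuple h (tnth v ord0); h (tnth v ord_max)].
  by apply: eq_from_tnth => i; rewrite tnth_map; case: i => [[|[|]] //= Hi];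
     congr h; congr tnth; exact: val_inj.
set x := tnth v ord0; set y := tnth v ord_max.
rewrite {1}/rel_interp /=; case: b v @x @y => v x y.
  rewrite -[RHS]/(adj (h x) (h y)); apply/idP/idP.
    by case/orP => /half //; rewrite adjC.
  have [sx _] := Hqq x; have [sy _] := Hqq y.
  by case/(sp_adj _ _ sx sy) => /half' H; apply/orP; [right|left].
rewrite -[RHS]/(ord (h x) (h y)) [LHS](_ : _ = (head None (val x) == head None (val y))) //.
by rewrite !headE; apply/eqP/idP => /ltP.
Qed.

End Reconstruction.

(** * Coding structures by trees *)

Section Coding.
Variables (C : countType) (L : language).

(* [None] is a dummy symbol that is always true, so that marks exist; the
   boolean is a polarity, which makes both a fact and its negation visible in
   the tree as the presence of a vertex. *)
Definition symb : countType := option (bool * (rsym L + fsym L))%type.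

Definition rcode (f : rsym L) : nat := pickle (Some (true, inl f) : symb).
Definition fcode (f : fsym L) : nat := pickle (Some (true, inr f) : symb).

(** The string may have any length: [nth] ignores surplus letters and pads missing arguments with
    [a]. For a function symbol [a] is also the claimed value. Numbers that code no symbol count as
    true facts. *)
Definition facts (A : countType) (M : structure L A) (m : nat) (a : A) (s : seq A) : bool :=
  match unpickle m : option symb with
  | Some (Some (b, inl f)) => b == rel_interp M [tuple nth a s i | i < rel_arity f]
  | Some (Some (b, inr f)) =>
      b == (fun_interp M [tuple nth a s i | i < fun_arity f] == a)
  | _ => true
  end.

(** All facts, padded or negated, are tied to positive facts at arguments of full length, so that
    together they describe one structure. The existential over [d] reflects that a relation does not
    depend on the letter accompanying its arguments. *)
Definition symbol_axiom (T : countType) (t : structure (tree_language C) T) (r : T)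
    (m : nat) : Prop :=
  match unpickle m : option symb with
  | Some (Some (b, inl f)) => forall a s, elem t r a -> all (elem t r) s ->
      (fact t r m a s <-> (b <-> exists d, elem t r d /\
         fact t r (rcode f) d [seq nth a s i | i : 'I_(rel_arity f)]))
  | Some (Some (b, inr f)) =>
      (forall s, all (elem t r) s -> size s = fun_arity f ->
         exists v, [/\ elem t r v, fact t r (fcode f) v s &
           forall v', elem t r v' -> fact t r (fcode f) v' s -> v' = v]) /\
      forall a s, elem t r a -> all (elem t r) s ->
        (fact t r m a s <-> (b <->
           fact t r (fcode f) a [seq nth a s i | i : 'I_(fun_arity f)]))
  | _ => forall a s, elem t r a -> all (elem t r) s -> fact t r m a s
  end.

Definition coded (T : countType) (t : structure (tree_language C) T) (r : T) : Prop :=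
  [/\ tree_axioms t r, word_axioms t r & forall m, symbol_axiom t r m].

Lemma mktuple_nth (A : Type) (a : A) n (v : n.-tuple A) :
  [tuple nth a v i | i < n] = v.
Proof. by apply: eq_from_tnth => i; rewrite tnth_mktuple (tnth_nth a). Qed.

Lemma nth_map_default (A B : Type) (f : A -> B) (a : A) (s : seq A) i :
  nth (f a) (map f s) i = f (nth a s i).
Proof.
by have [lti|lei] := ltnP i (size s); [exact: nth_map|rewrite !nth_default ?size_map].
Qed.

Lemma facts_rcode (A : countType) (M : structure L A) f a s :
  facts M (rcode f) a s = rel_interp M [tuple nth a s i | i < rel_arity f].
Proof. by rewrite /facts /rcode pickleK; case: rel_interp. Qed.

Lemma facts_fcode (A : countType) (M : structure L A) f a s :
  facts M (fcode f) a s = (fun_interp M [tuple nth a s i | i < fun_arity f] == a).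
Proof. by rewrite /facts /fcode pickleK; case: (_ == a). Qed.

Lemma iff_bool (b c : bool) (P : Prop) : (P <-> c) -> (b == c <-> (b <-> P)).
Proof.
move=> ->; split=> [/eqP ->//|[H1 H2]]; apply/eqP.
by case: b c H1 H2 => [] [] // H1 H2; [exact/esym/H1|exact: H2].
Qed.

Section OfStructure.
Variables (A : countType) (M : structure L A).
Local Notation t := (wtree C (facts M)).
Local Notation r := (vroot (facts M)).
Local Notation emb := (vemb (facts M)).

Lemma wtree_coded : inhabited A -> coded t r.
Proof.
move=> iA; split; [exact: wtree_axioms|exact: wtree_words|move=> m].
have nthE n a s : [seq nth (emb a) (map emb s) i | i : 'I_n] =
    map emb [seq nth a s i | i : 'I_n].
  by rewrite -map_comp; apply: eq_map => i /=; rewrite nth_map_default.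
rewrite /symbol_axiom.
have Em a s : fact t r m (emb a) (map emb s) <-> facts M m a s by exact: fact_vemb.
case Um : (unpickle m) => [[[b [f|f]]|]|].
- move=> _ _ /elem_vemb[a ->] /all_elem_vemb[s ->].
  rewrite nthE Em [facts M m a s]/facts Um; apply: iff_bool; split=> [[d []]|H].
    move=> /elem_vemb[c ->] /fact_vemb; rewrite facts_rcode.
    by rewrite (mktuple_nth c [tuple nth a s i | i < rel_arity f]).
  exists (emb a); split; first by apply/elem_vemb; exists a.
  by apply/fact_vemb; rewrite facts_rcode (mktuple_nth a [tuple nth a s i | i < rel_arity f]).
- split.
    move=> _ /all_elem_vemb[s ->]; rewrite size_map => /eqP Es.
    pose v : (fun_arity f).-tuple A := Tuple Es.
    exists (emb (fun_interp M v)); split; first by apply/elem_vemb; eexists.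
      by apply/fact_vemb; rewrite facts_fcode (mktuple_nth _ v).
    move=> _ /elem_vemb[a ->] /fact_vemb; rewrite facts_fcode (mktuple_nth _ v).
    by move/eqP ->.
  move=> _ _ /elem_vemb[a ->] /all_elem_vemb[s ->].
  rewrite nthE Em [facts M m a s]/facts Um; apply: iff_bool; rewrite fact_vemb facts_fcode.
  by rewrite (mktuple_nth a [tuple nth a s i | i < fun_arity f]).
- by move=> _ _ /elem_vemb[a ->] /all_elem_vemb[s ->]; apply/fact_vemb; rewrite /facts Um.
- by move=> _ _ /elem_vemb[a ->] /all_elem_vemb[s ->]; apply/fact_vemb; rewrite /facts Um.
Qed.

End OfStructure.

(** The structure is read off the positive facts; by [symbol_axiom] its [facts] are then those
    visible in the tree, so [wtree_reconstruct] applies. The enumeration [e] of the elements is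
    free, which later allows the universe to be prescribed. *)
Lemma coded_reconstruct (T A : countType) (t : structure (tree_language C) T) r
    (e : A -> T) :
  is_tree (adj t) ->
  [/\ reflexive (order_rel t), symmetric (order_rel t) & transitive (order_rel t)] ->
  coded t r -> injective e -> (forall x, elem t r x <-> exists a, e a = x) ->
  exists M : structure L A, exists2 h : vtx (facts M) -> T,
    is_iso (wtree C (facts M)) t h &
    h (vroot (facts M)) = r /\ forall a, h (vemb (facts M) a) = e a.
Proof.
move=> [_ adjC _ _] [ordR ordC ordT] [treeA wordA symA] ei eE.
have el a : elem t r (e a) by apply/eE; exists a.
have els s : all (elem t r) (map e s) by rewrite all_map; apply/allP => a _ /=.
have nthE n a s : [seq nth (e a) (map e s) i | i : 'I_n] =
    map e [seq nth a s i | i : 'I_n].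
  by rewrite -map_comp; apply: eq_map => i /=; rewrite nth_map_default.
have /choice[fv Hfv] : forall x : {f : fsym L & (fun_arity f).-tuple A}, exists v : A,
    forall a, fact t r (fcode (tag x)) (e a) (map e (tagged x)) <-> v = a.
  case=> f v /=; have := symA (fcode f); rewrite /symbol_axiom /fcode pickleK.
  move=> [/(_ (map e v) (els v))] []; first by rewrite size_map size_tuple.
  move=> _ [/eE[c <-] fc uc] _; exists c => a; split=> [/(uc _ (el a))/ei//|<-//].
pose M : structure L A := (fv, fun x : {f : rsym L & (rel_arity f).-tuple A} => `[< exists d : A,
  fact t r (rcode (tag x)) (e d) (map e (tagged x)) >]).
have := wtree_reconstruct adjC ordR ordC ordT treeA wordA ei eE.
have -> : (fun m a s => `[< fact t r m (e a) (map e s) >]) = facts M.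
  apply: funext => m; apply: funext => a; apply: funext => s; apply: asbool_equiv_eqP.
    exact: idP.
  rewrite /facts; have := symA m; rewrite /symbol_axiom.
  case Um : (unpickle m) => [[[b [f|f]]|]|].
  - move=> /(_ (e a) (map e s) (el a) (els s)) ->; apply: iff_sym; apply: iff_bool.
    rewrite nthE; split=> [[_ [/eE[d <-] Hd]]|/asboolP[d Hd]].
      by apply/asboolP; exists d.
    by exists (e d).
  - case=> _ /(_ (e a) (map e s) (el a) (els s)) ->; apply: iff_sym; apply: iff_bool.
    have Hv := Hfv (existT (fun f => (fun_arity f).-tuple A) f
      [tuple nth a s i | i < fun_arity f]) a.
    by rewrite nthE; apply: iff_trans Hv _; split=> /eqP.
  - by move=> /(_ (e a) (map e s) (el a) (els s)).
  - by move=> /(_ (e a) (map e s) (el a) (els s)).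
by move=> H; exists M.
Qed.

Lemma facts_iso (A B : countType) (M : structure L A) (N : structure L B) (g : A -> B) :
  is_iso M N g -> forall m a s, facts N m (g a) (map g s) = facts M m a s.
Proof.
move=> [bg gf gr] m a s; rewrite /facts; case: (unpickle m) => [[[b [f|f]]|]|] //.
  rewrite gr; congr (b == rel_interp N _); apply: eq_from_tnth => i.
  by rewrite [RHS]tnth_map !tnth_mktuple nth_map_default.
rewrite -(bij_eq bg) gf; congr (b == (fun_interp N _ == _)); apply: eq_from_tnth => i.
by rewrite [RHS]tnth_map !tnth_mktuple nth_map_default.
Qed.

(** Graphs of functions and relations occur among the facts at strings of full length; [a0] supplies
    the letter that accompanies the arguments of a relation. *)
Lemma iso_of_facts (A B : countType) (M : structure L A) (N : structure L B) (g : A -> B) :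
  inhabited A -> bijective g ->
  (forall m a s, facts N m (g a) (map g s) = facts M m a s) -> is_iso M N g.
Proof.
case=> a0 bg H; split=> // [f v|f v].
  have := H (fcode f) (fun_interp M v) v; rewrite !facts_fcode mktuple_nth eqxx.
  by rewrite (mktuple_nth _ (map_tuple g v)) => /eqP ->.
have := H (rcode f) a0 v; rewrite !facts_rcode mktuple_nth.
by rewrite (mktuple_nth _ (map_tuple g v)).
Qed.

End Coding.

(** * Translating formulas *)

Lemma definable_iso (L : language) (X : finType) (P : dpred L X) (T U : countType)
    (M : structure L T) (N : structure L U) h e :
  definable P -> is_iso M N h -> P T M e <-> P U N (fun x => h (e x)).
Proof. by case=> F HF ih; rewrite -!HF (holds_iso ih). Qed.

Section TreeDefinability.
Variables (C : countType) (L : language).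
Local Notation TL := (tree_language C).

Section Atoms.
Variable X : finType.
Implicit Types (r x y a : X) (vs us : seq X).

Lemma def_and3 (P Q R : dpred TL X) : definable P -> definable Q -> definable R ->
  definable (fun T t e => [/\ P T t e, Q T t e & R T t e]).
Proof.
move=> HP HQ HR; apply: (def_ext _ (def_and HP (def_and HQ HR))) => T t e.
by split=> [[? []]|[]].
Qed.

Lemma def_and5 (P Q R S W : dpred TL X) : definable P -> definable Q ->
  definable R -> definable S -> definable W ->
  definable (fun T t e => [/\ P T t e, Q T t e, R T t e, S T t e & W T t e]).
Proof.
move=> HP HQ HR HS HW.
apply: (def_ext _ (def_and HP (def_and HQ (def_and3 HR HS HW)))) => T t e.
by split=> [[? [? []]]|[]].
Qed.

Lemma def_binary b x y : definable (fun T (t : structure TL T) (e : X -> T) =>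
  @rel_interp TL T t b [tuple e x; e y]).
Proof.
exists (binary (C := C) b (enum_rank x) (enum_rank y)) => T t e.
by rewrite holds_binary !enum_rankK.
Qed.

Lemma def_adj x y : definable (fun T (t : structure TL T) (e : X -> T) => adj t (e x) (e y)).
Proof. exact: def_binary. Qed.

Lemma def_ord x y :
  definable (fun T (t : structure TL T) (e : X -> T) => order_rel t (e x) (e y)).
Proof. exact: def_binary. Qed.

Lemma head_map_default (A B : Type) (f : A -> B) (a : A) s :
  head (f a) (map f s) = f (head a s).
Proof. by case: s. Qed.

Lemma def_spine r vs :
  definable (fun T (t : structure TL T) (e : X -> T) => spine t (e r) (map e vs)).
Proof.
elim: vs => [|v vs IHvs] /=; first exact: def_const.
apply: def_andb.
  by apply: (def_ext _ (def_adj (head r vs) v)) => T t e; rewrite head_map_default.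
by apply: def_andb => //; apply: def_negb; exact: (def_in TL v (r :: vs)).
Qed.

Lemma def_all2 vs us :
  definable (fun T (t : structure TL T) (e : X -> T) =>
    all2 (order_rel t) (map e vs) (map e us)).
Proof.
elim: vs us => [|v vs IHvs] [|u us] /=; try exact: (def_const TL X true);
  try exact: (def_const TL X false).
by apply: def_andb => //; exact: def_ord.
Qed.

Lemma def_all_seq (p : forall T : countType, structure TL T -> (X -> T) -> pred T) vs :
  (forall v, definable (fun T t e => p T t e (e v))) ->
  definable (fun T (t : structure TL T) (e : X -> T) => all (p T t e) (map e vs)).
Proof.
move=> Hp; elim: vs => [|v vs IHvs] /=; first exact: def_const.
exact: def_andb.
Qed.

Lemma def_body r vs :
  definable (fun T (t : structure TL T) (e : X -> T) =>
    body ((order_rel t)^~ (e r)) (map e vs)).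
Proof.
elim: vs => [|v vs IHvs] /=; first exact: def_const.
apply: def_ifb => //; first exact: def_ord.
apply: (def_all_seq (p := fun T t e => (order_rel t)^~ (e r))) => u; exact: def_ord.
Qed.

Lemma def_marked r vs :
  definable (fun T (t : structure TL T) (e : X -> T) =>
    marked ((order_rel t)^~ (e r)) (map e vs)).
Proof.
case: vs => [|u [|v vs]]; try exact: (def_const TL X false).
rewrite /=; apply: def_andb; first exact: def_ord.
apply: def_andb; first by apply: def_negb; exact: def_ord.
exact: def_body.
Qed.

Lemma def_eqs vs us : definable (fun T (t : structure TL T) (e : X -> T) =>
  map e vs = map e us).
Proof.
elim: vs us => [|v vs IHvs] [|u us] /=.
- by apply: (def_ext _ (def_const TL X True)).
- apply: (def_ext _ (def_const TL X False)) => T t e; by split.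
- apply: (def_ext _ (def_const TL X False)) => T t e; by split.
- apply: (def_ext _ (def_and (def_eq TL v u) (IHvs us))) => T t e.
  by split=> [[-> ->]//|[-> ->]].
Qed.

Lemma def_elem r x :
  definable (fun T (t : structure TL T) (e : X -> T) => elem t (e r) (e x)).
Proof.
by apply: def_andb; [exact: def_adj|apply: def_negb; exact: def_ord].
Qed.

Lemma def_all_elem r vs :
  definable (fun T (t : structure TL T) (e : X -> T) => all (elem t (e r)) (map e vs)).
Proof.
by apply: (def_all_seq (p := fun T t e => elem t (e r))) => v; exact: def_elem.
Qed.

End Atoms.

Lemma def_reach (X : finType) (r : X) us :
  definable (fun T (t : structure TL T) (e : X -> T) => reach t (e r) (map e us)).
Proof.
apply: (@def_ext _ _ (fun T t e => exists q, spine t (e r) q /\ all2 (order_rel t) q (map e us))).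
  by move=> T t e; split=> [[q [? ?]]|[q ? ?]]; exists q.
apply: def_exs => Y g vs; cbv beta; apply: def_and; first exact: def_spine.
apply: (def_ext _ (def_all2 vs (map g us))) => T t e.
by rewrite -map_comp.
Qed.

Lemma def_fact (X : finType) (r : X) m a vs :
  definable (fun T (t : structure TL T) (e : X -> T) =>
    fact t (e r) m (e a) (map e vs)).
Proof.
apply: (def_ext _ (def_reach r (r :: a :: vs ++ nseq m r))) => T t e.
by rewrite /fact /= map_cat map_nseq.
Qed.

Lemma def_alls2 (X : finType)
    (P : forall T : countType, structure TL T -> seq T -> seq T -> (X -> T) -> Prop) :
  (forall (Y : finType) (g : X -> Y) (vs us : seq Y),
     definable (fun T M (e : Y -> T) => P T M (map e vs) (map e us) (fun x => e (g x)))) ->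
  definable (fun T M e => forall q q', P T M q q' e).
Proof.
move=> HP; apply: def_alls => Y g vs; cbv beta.
apply: (def_alls (P := fun T M q e => P T M (map e vs) q (fun x => e (g x)))) => Z h us.
apply: (def_ext _ (HP Z (fun x => h (g x)) (map h vs) us)) => T t e.
by rewrite -map_comp.
Qed.

Lemma def_tree_axioms (X : finType) (r : X) :
  definable (fun T (t : structure TL T) (e : X -> T) => tree_axioms t (e r)).
Proof.
apply: def_and5.
- apply: (def_bigand (P := fun c T t e => forall v : 0.-tuple T,
    @fun_interp TL T t c v = e r)) => c.
  exists (Equal (@App TL _ c (fun i : 'I_0 => False_rect _ (notF (ltn_ord i))))
                (Var TL (enum_rank r))) => T t e /=.
  rewrite enum_rankK; split=> [<- v|H]; last exact: H.
  by congr fun_interp; apply: eq_from_tnth => -[].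
- apply: def_all => Y g v; cbv beta.
  apply: (@def_ext _ _ (fun T t e => exists q, spine t (e (g r)) q /\ head (e (g r)) q = e v)).
    by move=> T t e; split=> [[q [? ?]]|[q ? ?]]; exists q.
  apply: def_exs => Z h vs; cbv beta; apply: def_and; first exact: def_spine.
  apply: (def_ext _ (def_eq TL (head (h (g r)) vs) (h v))) => T t e.
  by rewrite head_map_default.
- apply: def_alls2 => Y g vs us; cbv beta.
  apply: def_imp; first exact: def_spine.
  apply: def_imp; first exact: def_spine.
  apply: def_imp; last exact: def_eqs.
  apply: (def_ext _ (def_eq TL (head (g r) vs) (head (g r) us))) => T t e.
  by rewrite !head_map_default.
- apply: def_alls2 => Y g vs us; cbv beta.
  have half ws ws' : definable (fun T (t : structure TL T) (e : Y -> T) =>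
      map e ws != [::] /\ behead (map e ws) = map e ws').
    apply: (def_ext _ (def_and (def_const TL Y (ws != [::])) (def_eqs (behead ws) ws'))).
    by move=> T t e; rewrite behead_map; case: ws.
  apply: def_imp; first exact: def_spine.
  apply: def_imp; first exact: def_spine.
  apply: def_imp; last exact: def_or.
  apply: (def_ext _ (def_adj (head (g r) vs) (head (g r) us))) => T t e.
  by rewrite !head_map_default.
- apply: def_alls2 => Y g vs us; cbv beta.
  apply: def_imp; first exact: def_spine.
  apply: def_imp; first exact: def_spine.
  apply: def_imp; last exact: def_eqs.
  exact: def_all2.
Qed.

Lemma def_word_axioms (X : finType) (r : X) :
  definable (fun T (t : structure TL T) (e : X -> T) => word_axioms t (e r)).
Proof.
apply: def_and3.
- by apply: def_ex => Y g v; apply: def_negb; exact: def_ord.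
- apply: def_alls => Y g vs; cbv beta.
  by apply: def_imp; [exact: def_body|exact: def_reach].
- apply: def_alls => Y g vs; cbv beta; apply: def_imp; first exact: def_spine.
  apply: (def_ext _ (def_or (def_body (g r) vs) (def_marked (g r) vs))) => T t e.
  by split=> /orP.
Qed.

Lemma def_symbol_axiom (X : finType) (r : X) m :
  definable (fun T (t : structure TL T) (e : X -> T) => symbol_axiom L t (e r) m).
Proof.
rewrite /symbol_axiom.
have nth_seqE (A B : Type) (f : A -> B) n a s :
    [seq f x | x <- [seq nth a s i | i : 'I_n]] =
    [seq nth (f a) [seq f x | x <- s] i | i : 'I_n].
  by rewrite -map_comp; apply: eq_map => i /=; rewrite nth_map_default.
have guard (Q : forall T : countType, structure TL T -> T -> T -> seq T -> Prop) :
    (forall (Y : finType) (q a : Y) vs,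
       definable (fun T (t : structure TL T) (e : Y -> T) => Q T t (e q) (e a) (map e vs))) ->
    definable (fun T (t : structure TL T) (e : X -> T) =>
      forall a s, elem t (e r) a -> all (elem t (e r)) s -> Q T t (e r) a s).
  move=> HQ; apply: def_all => Y g v; cbv beta; apply: def_alls => Z h vs; cbv beta.
  apply: def_imp; first exact: def_elem.
  by apply: def_imp; [exact: def_all_elem|exact: HQ].
case: (unpickle m : option (symb L)) => [[[b [f|f]]|]|].
- apply: (guard (fun T t q a s => fact t q m a s <-> (b <-> exists d, elem t q d /\
    fact t q (rcode f) d [seq nth a s i | i : 'I_(rel_arity f)]))) => Y q a vs.
  apply: def_iff; first exact: def_fact.
  apply: def_iff; first exact: def_const.
  apply: def_ex => Z h v; cbv beta; apply: def_and; first exact: def_elem.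
  apply: (def_ext _ (def_fact (h q) (rcode f) v
    (map h [seq nth a vs i | i : 'I_(rel_arity f)]))) => T t e.
  by rewrite -map_comp nth_seqE; under eq_map do rewrite /=.
- apply: def_and.
    apply: def_alls => Y g vs; cbv beta; apply: def_imp; first exact: def_all_elem.
    apply: def_imp.
      by apply: (def_ext _ (def_const TL Y (size vs = fun_arity f))) => T t e;
         rewrite size_map.
    apply: def_ex => Z h v; cbv beta; apply: def_and3; first exact: def_elem.
      apply: (def_ext _ (def_fact (h (g r)) (fcode f) v (map h vs))) => T t e.
      by rewrite -map_comp.
    apply: def_all => W k v'; cbv beta; apply: def_imp; first exact: def_elem.
    apply: def_imp; last exact: def_eq.
    apply: (def_ext _ (def_fact (k (h (g r))) (fcode f) v' (map k (map h vs)))) => T t e.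
    by rewrite -!map_comp.
  apply: (guard (fun T t q a s => fact t q m a s <-> (b <->
    fact t q (fcode f) a [seq nth a s i | i : 'I_(fun_arity f)]))) => Y q a vs.
  apply: def_iff; first exact: def_fact.
  apply: def_iff; first exact: def_const.
  apply: (def_ext _ (def_fact q (fcode f) a [seq nth a vs i | i : 'I_(fun_arity f)])) => T t e.
  by rewrite nth_seqE.
- by apply: (guard (fun T t q a s => fact t q m a s)) => Y q a vs; exact: def_fact.
- by apply: (guard (fun T t q a s => fact t q m a s)) => Y q a vs; exact: def_fact.
Qed.

Lemma def_coded (X : finType) (r : X) :
  definable (fun T (t : structure TL T) (e : X -> T) => coded L t (e r)).
Proof.
apply: def_and3; [exact: def_tree_axioms|exact: def_word_axioms|].
by apply: (def_bigand (P := fun m T t e => symbol_axiom L t (e r) m)) => m;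
   exact: def_symbol_axiom.
Qed.

Definition tpred (n : nat) :=
  forall T : countType, structure TL T -> T -> ('I_n -> T) -> Prop.

(** The root is an additional argument, and the variables may sit anywhere in any context; this
    built-in closure under renaming lets the inductive steps nest quantifiers. *)
Definition tdefinable n (P : tpred n) : Prop :=
  forall (Y : finType) (r : Y) (s : 'I_n -> Y),
    definable (fun T t (e : Y -> T) => P T t (e r) (fun i => e (s i))).

Definition translates n (P : tpred n) (Q : forall A : countType, structure L A -> ('I_n -> A) -> Prop) :=
  forall (A : countType) (M : structure L A) (e : 'I_n -> A), inhabited A ->
    P _ (wtree C (facts M)) (vroot (facts M)) (fun i => vemb (facts M) (e i)) <-> Q A M e.

(** A term is translated into its graph, with [ord0] for the value. For [App] the values of the
    arguments are collected in a string of elements at which the mark of [fcode f] must be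
    present. *)
Lemma translate_term n (s : term L n) : exists P : tpred n.+1,
  tdefinable P /\ translates P (fun A M e => eval M (fun i => e (lift ord0 i)) s = e ord0).
Proof.
have emb_inj (A : countType) (M : structure L A) : injective (vemb (facts M)).
  by move=> a b [].
elim: s => [i|f a IHa].
  exists (fun T t r e => e (lift ord0 i) = e ord0); split.
    by move=> Y r s; exact: def_eq.
  by move=> A M e _; split=> [/emb_inj|/= ->].
have /choice[P HP] := IHa.
(* The string [ys] may be too short; the default of [nth] is the value [e ord0], in accordance with
   the padding in [facts]. *)
exists (fun T t r e => exists ys, [/\ all (elem t r) ys,
  fact t r (fcode f) (e ord0) ys &
  forall i : 'I_(fun_arity f), P i T t r
    (push (nth (e ord0) ys i) (fun j => e (lift ord0 j)))]); split.
  move=> Y r s; apply: def_exs => Z g vs; cbv beta; apply: def_and3.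
  - exact: def_all_elem.
  - exact: def_fact.
  - apply: (def_bigand (P := fun (i : 'I_(fun_arity f)) T t e => P i T t (e (g r))
      (push (nth (e (g (s ord0))) (map e vs) i) (fun j => e (g (s (lift ord0 j))))))) => i.
    have [dP _] := HP i.
    apply: (def_ext _ (dP Z (g r) (push (nth (g (s ord0)) vs i)
      (fun j => g (s (lift ord0 j)))))) => T t e.
    by rewrite (push_comp e) nth_map_default.
have pushE (A : countType) (M : structure L A) (x : A) (e : 'I_n -> A) :
    push (vemb (facts M) x) (fun j => vemb (facts M) (e j)) =
    (fun i => vemb (facts M) (push x e i)) by rewrite push_comp.
have evalE (A : countType) (M : structure L A) (e : 'I_n.+1 -> A) ys :
    (forall i : 'I_(fun_arity f),
       eval M (fun j => e (lift ord0 j)) (a i) = nth (e ord0) ys i) ->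
    eval M (fun i => e (lift ord0 i)) (App a) =
    fun_interp M [tuple nth (e ord0) ys i | i < fun_arity f].
  by move=> H /=; congr fun_interp; apply: eq_from_tnth => i; rewrite !tnth_mktuple.
have PE (A : countType) (M : structure L A) (e : 'I_n.+1 -> A) ys i : inhabited A ->
    P i _ (wtree C (facts M)) (vroot (facts M))
      (push (nth (vemb (facts M) (e ord0)) (map (vemb (facts M)) ys) i)
            (fun j => vemb (facts M) (e (lift ord0 j)))) <->
    eval M (fun j => e (lift ord0 j)) (a i) = nth (e ord0) ys i.
  move=> iA; have [_ tP] := HP i; rewrite nth_map_default pushE (tP A M _ iA).
  have -> : (fun j => push (nth (e ord0) ys i) (fun j => e (lift ord0 j)) (lift ord0 j)) =
    (fun j => e (lift ord0 j)) by apply: funext => j; rewrite /push liftK.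
  by rewrite {1}/push unlift_none.
move=> A M e iA; split.
  case=> _ [/all_elem_vemb[ys ->] /fact_vemb + H].
  by rewrite facts_fcode => /eqP <-; apply: evalE => i; apply/PE.
move=> Ee; exists (map (vemb (facts M)) [tuple eval M (fun j => e (lift ord0 j)) (a i) | i < fun_arity f]).
split; first exact: all_elem_map.
  by apply/fact_vemb; rewrite facts_fcode mktuple_nth; apply/eqP.
move=> i; apply/PE => //; rewrite -[RHS]tnth_nth tnth_mktuple //.
Qed.

End TreeDefinability.

Section Translation.
Variables (C : countType) (L : language).
Local Notation TL := (tree_language C).

(** Quantifiers are relativised to [elem]. An equation asks for a common value of its terms, and a
    relation for a string of values carrying the corresponding mark. *)
Lemma translate_formula n (F : formula L n) : exists P : tpred C n,
  tdefinable P /\ translates P (fun A M e => holds M F e).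
Proof.
have pushE k (A : countType) (M : structure L A) (x : A) (e : 'I_k -> A) :
    push (vemb (facts M) x) (fun j => vemb (facts M) (e j)) =
    (fun i => vemb (facts M) (push x e i)) by rewrite push_comp.
have push0 k (A : Type) (x : A) (e : 'I_k -> A) : push x e ord0 = x.
  by rewrite /push unlift_none.
have pushS k (A : Type) (x : A) (e : 'I_k -> A) :
    (fun i => push x e (lift ord0 i)) = e.
  by apply: funext => i; rewrite /push liftK.
elim: F => {n} [n s1 s2|n f a|n F [P [dP tP]]|n F IHF|n F [P [dP tP]]].
- have [P1 [dP1 tP1]] := translate_term C s1; have [P2 [dP2 tP2]] := translate_term C s2.
  exists (fun T t r e => exists y, [/\ elem t r y, P1 T t r (push y e) & P2 T t r (push y e)]).
  split.
    move=> Y r s; apply: def_ex => Z g v; cbv beta; apply: def_and3.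
    + exact: def_elem.
    + apply: (def_ext _ (dP1 Z (g r) (push v (fun i => g (s i))))) => T t e.
      by rewrite (push_comp e).
    + apply: (def_ext _ (dP2 Z (g r) (push v (fun i => g (s i))))) => T t e.
      by rewrite (push_comp e).
  move=> A M e iA; split=> /=.
    case=> _ [/elem_vemb[y ->]]; rewrite pushE tP1 // tP2 // !pushS !push0.
    by move=> -> ->.
  move=> E; exists (vemb (facts M) (eval M e s1)); rewrite pushE.
  by split; [apply/elem_vemb; eexists|apply/tP1|apply/tP2]; rewrite ?pushS ?push0.
- have /choice[P HP] := fun i => translate_term C (a i).
  exists (fun T t r e => exists d ys, [/\ elem t r d /\ all (elem t r) ys,
    fact t r (rcode f) d ys &
    forall i : 'I_(rel_arity f), P i T t r (push (nth d ys i) e)]); split.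
    move=> Y r s; apply: def_ex => Z g v; cbv beta; apply: def_exs => W h vs; cbv beta.
    apply: def_and3; first by apply: def_and; [exact: def_elem|exact: def_all_elem].
      exact: def_fact.
    apply: (def_bigand (P := fun (i : 'I_(rel_arity f)) T t e => P i T t (e (h (g r)))
      (push (nth (e (h v)) (map e vs) i) (fun j => e (h (g (s j))))))) => i.
    have [dP _] := HP i.
    apply: (def_ext _ (dP W (h (g r)) (push (nth (h v) vs i)
      (fun j => h (g (s j)))))) => T t e.
    by rewrite (push_comp e) nth_map_default.
  have PE (A : countType) (M : structure L A) (e : 'I_n -> A) d ys i : inhabited A ->
      P i _ (wtree C (facts M)) (vroot (facts M))
        (push (nth (vemb (facts M) d) (map (vemb (facts M)) ys) i)
              (fun j => vemb (facts M) (e j))) <->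
      eval M e (a i) = nth d ys i.
    by move=> iA; have [_ tP] := HP i; rewrite nth_map_default pushE (tP A M _ iA) pushS push0.
  move=> A M e iA; split=> /=.
    case=> _ [_ [[/elem_vemb[d ->] /all_elem_vemb[ys ->]] /fact_vemb + H]].
    rewrite facts_rcode; set u := mktuple _; set v := mktuple _; suff -> : u = v by [].
    apply: eq_from_tnth => i; rewrite !tnth_mktuple; apply/esym; exact/PE.
  move=> Hf; case: (iA) => d; exists (vemb (facts M) d).
  exists (map (vemb (facts M)) [tuple eval M e (a i) | i < rel_arity f]).
  split; first by split; [apply/elem_vemb; exists d|exact: all_elem_map].
    by apply/fact_vemb; rewrite facts_rcode mktuple_nth.
  by move=> i; apply/PE => //; rewrite -[RHS]tnth_nth tnth_mktuple.
- exists (fun T t r e => ~ P T t r e); split; first by move=> Y r s; apply: def_not; exact: dP.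
  by move=> A M e iA /=; rewrite (tP A M e iA).
- have /choice[P HP] := IHF.
  exists (fun T t r e => forall k, P k T t r e); split.
    move=> Y r s; apply: (def_bigand (P := fun k T t e => P k T t (e r) (fun i => e (s i)))) => k.
    by have [dP _] := HP k; exact: dP.
  by move=> A M e iA; split=> H k; have [_ tP] := HP k; apply/tP.
- exists (fun T t r e => exists x, elem t r x /\ P T t r (push x e)); split.
    move=> Y r s; apply: def_ex => Z g v; cbv beta; apply: def_and; first exact: def_elem.
    apply: (def_ext _ (dP Z (g r) (push v (fun i => g (s i))))) => T t e.
    by rewrite (push_comp e).
  move=> A M e iA; split=> /=.
    by case=> _ [/elem_vemb[x ->]]; rewrite pushE tP //; exists x.
  by case=> x Hx; exists (vemb (facts M) x); rewrite pushE tP.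
Qed.

(** [psi] adds to the tree axioms that some vertex [r] codes a structure and satisfies the
    translation of [phi]. A structure whose word tree is mapped onto the given tree with root at [r]
    inherits [phi], because definable predicates are invariant under isomorphism. *)
Lemma coding_sentence (phi : sentence L) : exists psi : sentence TL,
  [/\ entails psi (tree_equivalence_sentence C),
      forall (A : countType) (M : structure L A), inhabited A ->
        satisfies M phi -> satisfies (wtree C (facts M)) psi &
      forall (T : countType) (t : structure TL T), satisfies t psi ->
        exists2 r, coded L t r &
          forall (A : countType) (M : structure L A) (h : vtx (facts M) -> T),
            inhabited A -> is_iso (wtree C (facts M)) t h -> h (vroot (facts M)) = r ->
            satisfies M phi].
Proof.
have [P [dP tP]] := translate_formula phi.
pose e0 (T : Type) (i : 'I_0) : T := False_rect T (notF (ltn_ord i)).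
have dPr (Y : finType) (r : Y) : definable (fun T (t : structure TL T) (e : Y -> T) =>
    coded L t (e r) /\ P T t (e r) (e0 T)).
  apply: def_and; first exact: def_coded.
  apply: (def_ext _ (dP Y r (e0 Y))) => T t e.
  by rewrite (env0 (fun i => e (e0 Y i)) (e0 T)).
have [psi Hpsi] : exists psi : sentence TL, forall (T : countType) (t : structure TL T),
    satisfies t psi <-> exists r, coded L t r /\ P T t r (e0 T).
  by apply: definable_sentence; apply: def_ex => Y g v; exact: dPr.
exists (And2 (tree_equivalence_sentence C) psi); split.
- by move=> T M _ /satisfies_And2[].
- move=> A M iA Mphi; apply/satisfies_And2; split.
    apply/tree_equivalence_sentenceP; split; first exact: wtree_is_tree.
    exact: wtree_equivalence.
  apply/Hpsi; exists (vroot (facts M)); split; first exact: wtree_coded.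
  by rewrite (env0 (e0 _) (fun i => vemb (facts M) (e0 A i))) tP.
- move=> T t /satisfies_And2[_ /Hpsi[r [cr Pr]]]; exists r => // A M h iA ih hr.
  have dPu := dP unit tt (e0 unit).
  have := definable_iso (fun=> vroot (facts M)) dPu ih; cbv beta; rewrite hr.
  rewrite (env0 (fun _ => r) (e0 T)) (env0 (fun _ => vroot _) (fun i => vemb (facts M) (e0 A i))).
  rewrite (tP A M (e0 A) iA) => -[_ /(_ Pr)].
  exact.
Qed.

End Translation.

(** * Recovering the root *)

Section WordTreeIso.
Variables (C A B : countType).
Variables (F : nat -> A -> seq A -> bool) (G : nat -> B -> seq B -> bool).
Variable g : A -> B.
Hypothesis bg : bijective g.
Hypothesis FG : forall m a s, G m (g a) (map g s) = F m a s.

Lemma wf_map w : wf G (map (omap g) w) = wf F w.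
Proof.
have N l : none (omap g l) = none l by case: l.
have bodyE v : body (@none B) (map (omap g) v) = body (@none A) v by exact: body_map.
have cntE v : count (@none B) (map (omap g) v) = count (@none A) v.
  by rewrite count_map; apply: eq_count => l; rewrite /= N.
have pmapE v : pmap id (map (omap g) v) = map g (pmap id v).
  by elim: v => //= -[a|] v /= ->.
case: w => [|[a|] [|[b|] w]] //=; rewrite ?bodyE ?cntE ?pmapE ?FG // all_map;
  by apply: eq_all => l; rewrite /= N.
Qed.

Lemma wtree_iso : isomorphic (wtree C F) (wtree C G).
Proof.
have [g' gK g'K] := bg.
have oK : cancel (omap g) (omap g') by case=> //= a; rewrite gK.
have oK' : cancel (omap g') (omap g) by case=> //= a; rewrite g'K.
have Hh (v : vtx F) : wf G (map (omap g) (val v)) by rewrite wf_map; case: v.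
have Hk (v : vtx G) : wf F (map (omap g') (val v)).
  by rewrite -wf_map -map_comp map_id_in => [|l _ /=]; [case: v|exact: oK'].
pose h v : vtx G := exist (fun w => wf G w) _ (Hh v).
pose k v : vtx F := exist (fun w => wf F w) _ (Hk v).
exists h; split.
- by exists k => v; apply: val_inj; rewrite /= -map_comp map_id_in // => l _;
     rewrite /= (oK, oK').
- by move=> c v; apply: val_inj.
- have hE v : val (h v) = map (omap g) (val v) by [].
  have childE u v : child (val (h u)) (val (h v)) = child (val u) (val v).
    rewrite !hE; case: (val v) => //= l w.
    by rewrite (inj_eq (inj_map (can_inj oK))).
  have headE v : head None (val (h v)) = omap g (head None (val v)).
    by rewrite hE; case: (val v).
  move=> b v; rewrite /rel_interp /wtree /= !tnth_map.
  case: b v => v; first by rewrite !childE.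
  by rewrite !headE (inj_eq (can_inj oK)).
Qed.

End WordTreeIso.

Section RootLike.
Variable C : countType.
Local Notation TL := (tree_language C).

(* Quantified as [exists y z z', forall u u'], this says: some vertex equivalent
   to [x] is a leaf, [x] is not a leaf, and [x] has at most one neighbour in its
   own class. *)
Definition rootb (T : countType) (t : structure TL T) (x y z z' u u' : T) : bool :=
  [&& z != z', adj t x z, adj t x z', order_rel t y x,
      adj t y u && adj t y u' ==> (u == u') &
      [&& adj t x u, adj t x u', order_rel t u x & order_rel t u' x] ==> (u == u')].

Definition rootlike (T : countType) (t : structure TL T) (x : T) : Prop :=
  exists y z z', forall u u', rootb t x y z z' u u'.

Lemma rootlike_iso (T U : countType) (t : structure TL T) (u : structure TL U) h x :
  is_iso t u h -> rootlike t x -> rootlike u (h x).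
Proof.
move=> ih [y [z [z' H]]]; have [[h' hK h'K] _ _] := ih.
exists (h y), (h z), (h z') => v v'; rewrite -(h'K v) -(h'K v') /rootb.
by rewrite !(adj_iso ih) !(order_iso ih) !(inj_eq (can_inj hK)); exact: H.
Qed.

Variables (A : countType) (F : nat -> A -> seq A -> bool) (m0 : nat).
Hypothesis F0 : forall a s, F m0 a s.

Lemma wf_grow (a : A) w : body (@none A) w -> wf F (Some a :: w).
Proof. by move=> Hw; apply: body_wf. Qed.

Lemma wf_marked w l : wf F w -> ~~ body (@none A) w ->
  ~~ wf F (l :: w) /\ head None w = None.
Proof.
case: w => [|[b|] [|[c|] w]] //= H; rewrite ?H // => _; split=> //.
by case: l.
Qed.

(** The leaves are the marks, and their newest letter is None. A vertex with two neighbours in the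
    class of a leaf is therefore None^m for some m. If m > 0, its parent and its child None^(m+1)
    both lie in its class, whereas the root has a single neighbour there. *)
Lemma wtree_rootlike (v : vtx F) : inhabited A ->
  rootlike (wtree C F) v <-> v = vroot F.
Proof.
case=> a; split; last first.
  move=> ->; have Hy : wf F (None :: Some a :: map Some [::] ++ nseq m0 None).
    by rewrite wf_mark.
  pose mk w Hw : vtx F := exist (fun w => wf F w) w Hw.
  exists (mk _ Hy), (mk [:: None] isT), (vemb F a) => u u'.
  rewrite /rootb; apply/and5P; split=> //; apply/andP; split.
    apply/implyP; rewrite !wadjE -val_eqE.
    have nc w : wf F w -> child (val (mk _ Hy)) w = false.
      case: w => //= l w; apply: contraTF => /eqP ->.
      by apply: (proj1 (wf_marked _ Hy _)).
    rewrite !nc ?(valP u) ?(valP u') //=.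
    by move=> /andP[/eqP <- /eqP <-].
  apply/implyP => /and4P[]; rewrite !wadjE !ord_root -val_eqE /cls.
  case: u u' => [[|l w] Hw] [[|l' w'] Hw'] //=.
  by move=> /orP[]// /eqP -> /orP[]// /eqP ->; case: l {Hw}; case: l' {Hw'}.
case=> y [z [z' H]].
have nby : ~~ body (@none A) (val y).
  apply/negP => by_; pose ya : vtx F := exist (fun w => wf F w) _ (wf_grow a by_).
  have ay : adj (wtree C F) y ya by rewrite wadjE /= eqxx.
  (* A body word is never a leaf: besides the child [ya] it has its parent or, at the root, the
     child None. *)
  have [u [au nu]] : exists u, adj (wtree C F) y u /\ u <> ya.
    case: y {H} by_ @ya ay => -[|l w] Hw by_ ya ay.
      by exists (exist (fun w => wf F w) [:: None] isT); split.
    exists (exist (fun w => wf F w) w (wf_behead Hw)); split.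
      by rewrite wadjE /= eqxx orbT.
    by move/(congr1 (fun v : vtx F => size (val v))) => /= /eqP; rewrite ltn_eqF.
  have /and5P[_ _ _ _ /andP[+ _]] := H u ya; rewrite au ay /= => /eqP; exact: nu.
have clsv : head None (val v) = None.
  have /and5P[_ _ _ + _] := H y y; rewrite wordE /cls (proj2 (wf_marked None (valP y) nby)).
  by move/eqP.
have [nbv|bv] := boolP (body (@none A) (val v)); last first.
  have nc w : wf F w -> child (val v) w = false.
    case: w => //= l w; apply: contraTF => /eqP ->.
    by apply: (proj1 (wf_marked l (valP v) bv)).
  have /and5P[/eqP zz + + _ _] := H y y; rewrite !wadjE !nc ?(valP z) ?(valP z') //=.
  case: (val v) => //= l w /eqP E1 /eqP E2; case: zz; apply: val_inj.
  exact: etrans (esym E1) E2.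
apply: val_inj; case: v H clsv nbv => -[|l w] Hw //= H El.
rewrite El /= => aw; have Hu' : wf F [:: None, l & w] by apply: body_wf; rewrite El.
pose u : vtx F := exist (fun w => wf F w) _ (wf_behead Hw).
pose u' : vtx F := exist (fun w => wf F w) _ Hu'.
have /and5P[_ _ _ _ /andP[_ +]] := H u u'.
rewrite !wadjE !wordE /cls /= !eqxx !orbT El /= (_ : head None w = None) //.
  by rewrite -val_eqE /= => /eqP /(congr1 size) /= /eqP; rewrite ltn_eqF.
by case: w aw {Hw H Hu' u u'} => [|[]].
Qed.

End RootLike.

(** * Decoding *)

Section Reflection.
Variables (C : countType) (L : language).
Local Notation TL := (tree_language C).

Lemma facts_dummy (A : countType) (M : structure L A) a s :
  facts M (pickle (None : symb L)) a s.
Proof. by rewrite /facts pickleK. Qed.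

(** An isomorphism of the trees preserves [rootlike], hence maps root to root, elements to elements
    and marks to marks; restricted to elements it is an isomorphism of the structures. *)
Lemma wtree_iso_reflect (A B : countType) (M : structure L A) (N : structure L B) :
  inhabited A -> inhabited B ->
  isomorphic (wtree C (facts M)) (wtree C (facts N)) -> isomorphic M N.
Proof.
move=> iA iB [h ih]; have [[h' hK h'K] _ _] := ih.
have hr : h (vroot (facts M)) = vroot (facts N).
  apply/(wtree_rootlike C (facts_dummy N) _ iB); apply: rootlike_iso ih _.
  exact/(wtree_rootlike C (facts_dummy M)).
have /choice[g Hg] : forall a, exists b, h (vemb (facts M) a) = vemb (facts N) b.
  move=> a; apply/(elem_vemb C); rewrite -hr (elem_iso ih).
  by apply/elem_vemb; exists a.
have /choice[g' Hg'] : forall b, exists a, h' (vemb (facts N) b) = vemb (facts M) a.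
  move=> b; apply/(elem_vemb C); rewrite -(elem_iso ih) hr h'K.
  by apply/elem_vemb; exists b.
have bg : bijective g.
  exists g'.
    move=> a; have := Hg' (g a); rewrite -Hg hK => E.
    by have [] := congr1 val E.
  move=> b; have := Hg (g' b); rewrite -Hg' h'K => E.
  by have [] := congr1 val E.
exists g; apply: iso_of_facts => // m a s; apply/idP/idP.
  move/(fact_vemb C); rewrite -Hg -hr -map_comp (eq_map (g := h \o vemb (facts M))).
    by rewrite map_comp -(fact_iso ih) => /fact_vemb.
  by move=> b /=; rewrite Hg.
move/(fact_vemb C)/(fact_iso ih); rewrite hr Hg -map_comp.
rewrite (eq_map (g := vemb (facts N) \o g)); last by move=> b /=; rewrite Hg.
by rewrite map_comp => /fact_vemb.
Qed.

End Reflection.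

(** * Enumeration of a set by rank *)

Section Rank.
Variables (T : countType) (D : pred T).

(** The rank of [x] in [D] is [cnt (pickle x)], the number of elements of [D] with a smaller code.
    It depends on finitely many values of [D], so it will vary continuously with the tree. With
    [pickle_inv] each element is counted only at its own code. *)
Definition cnt k : nat := count (fun i => oapp D false (@pickle_inv T i)) (iota 0 k).

Lemma cntS k : cnt k.+1 = cnt k + oapp D false (@pickle_inv T k).
Proof. by rewrite /cnt -addn1 iotaD count_cat /= add0n addn0. Qed.

Lemma cnt_mono i j : i <= j -> cnt i <= cnt j.
Proof.
elim: j => [|j IHj]; first by rewrite leqn0 => /eqP ->.
rewrite leq_eqVlt => /predU1P[->//|/IHj H]; rewrite cntS; exact: leq_trans (leq_addr _ _).
Qed.

Lemma rank_inj x y : D x -> D y -> cnt (pickle x) = cnt (pickle y) -> x = y.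
Proof.
have lt_rank (u v : T) : D u -> pickle u < pickle v -> cnt (pickle u) < cnt (pickle v).
  by move=> Du /cnt_mono; rewrite cntS pickleK_inv /= Du addn1.
move=> Dx Dy E; apply: (pcan_inj pickleK).
case: (ltngtP (pickle x) (pickle y)) => // H.
  by have := lt_rank _ _ Dx H; rewrite E ltnn.
by have := lt_rank _ _ Dy H; rewrite E ltnn.
Qed.

Lemma rank_surj i (g : 'I_i.+1 -> T) : injective g -> (forall j, D (g j)) ->
  exists2 x, D x & cnt (pickle x) = i.
Proof.
move=> gi Dg.
have /ex_minnP[[|k] //] : exists k, i < cnt k.
  exists (\max_j (pickle (g j))).+1.
  have /uniq_leq_size : uniq [seq pickle (g j) | j : 'I_i.+1].
    by rewrite map_inj_uniq ?enum_uniq // => j j' /(pcan_inj pickleK)/gi.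
  move=> /(_ [seq l <- iota 0 (\max_j (pickle (g j))).+1 | oapp D false (@pickle_inv T l)]).
  rewrite size_map size_enum_ord size_filter; apply=> l /mapP[j _ ->].
  by rewrite mem_filter mem_iota pickleK_inv /= Dg add0n ltnS (leq_bigmax j).
rewrite cntS => Hk /(_ k); rewrite ltnn => Hmin.
have lek : cnt k <= i by rewrite leqNgt; apply/negP => /Hmin.
case E : (@pickle_inv T k) Hk => [x|] /=; last by rewrite addn0 ltnNge lek.
case Dx : (D x) => /=; last by rewrite addn0 ltnNge lek.
rewrite addn1 ltnS => gek; exists x => //.
have := @pickle_invK T k; rewrite E /= => ->; apply/eqP; rewrite eqn_leq lek; exact: gek.
Qed.

End Rank.

(* [k = 0] stands for the infinite cardinality. *)
Definition card_type (k : nat) : countType := if k is k'.+1 then 'I_k'.+1 : countType else nat.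

Definition card_val (k : nat) : card_type k -> nat :=
  match k with 0 => id | k'.+1 => fun i : 'I_k'.+1 => val i end.

(** Ranking replaces an arbitrary enumeration by one determined by [D] alone. For finite [D]
    surjectivity holds because an injection of a finite set into itself is onto. *)
Lemma rank_enum (T : countType) (D : pred T) k :
  (exists2 b : card_type k -> T, injective b & forall x, D x <-> exists i, b i = x) ->
  exists e : card_type k -> T, [/\ injective e, forall x, D x <-> exists i, e i = x &
    forall i, cnt D (pickle (e i)) = card_val i].
Proof.
case=> b bi bD; have Db i : D (b i) by apply/bD; exists i.
have /choice[e He] : forall i : card_type k, exists x, D x /\ cnt D (pickle x) = card_val i.
  move=> i; suff [g gi] : exists g : 'I_(card_val i).+1 -> card_type k, injective g.
    by have [x Dx Ex] := @rank_surj _ D _ _ (inj_comp bi gi) (fun=> Db _); exists x.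
  case: k b bi bD Db i => [|k] b bi bD Db i /=; first by exists val; exact: val_inj.
  by exists (widen_ord (ltn_ord i)) => x y /(congr1 val) /= /val_inj.
have vi : injective (@card_val k) by case: (k) => //= k'; exact: val_inj.
have ei : injective e.
  move=> i j E; apply: vi; have [_ <-] := He i; have [_ <-] := He j; by rewrite E.
exists e; split; [exact: ei| |by move=> i; have [] := He i].
move=> x; split=> [Dx|[i <-]]; last by have [] := He i.
suff [i Ei] : exists i : card_type k, card_val i = cnt D (pickle x).
  by exists i; have [De Ee] := He i; apply: rank_inj De Dx _; rewrite Ee.
case: k b bi bD Db e He vi ei => [|k] b bi bD Db e He vi ei; first by exists (cnt D (pickle x)).
have /choice[b' Hb'] : forall x, exists i, D x -> b i = x.
  by move=> y; have [/bD[i Ei]|nD] := pselect (D y); [exists i|exists ord0].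
have ci : injective (b' \o e).
  move=> i j /= /(congr1 b); have [Di _] := He i; have [Dj _] := He j.
  by rewrite !Hb' // => /ei.
have [c _ cK] := injF_bij ci; exists (c (b' x)); have [De <-] := He (c (b' x)).
congr (cnt D (pickle _)); have := cK (b' x); move/(congr1 b); rewrite /= !Hb' //.
Qed.

(** * Continuity with respect to the tree *)

Section LocallyConstant.
Variables (C T : countType).
Local Notation TL := (tree_language C).

(** Continuity into a discrete space. *)
Definition locconst (Y : Type) (f : structure TL T -> Y) : Prop :=
  forall t, exists n, forall t', agree n t t' -> f t' = f t.

Lemma locconst_const (Y : Type) (y : Y) : locconst (fun=> y).
Proof. by move=> t; exists 0. Qed.

Lemma locconst2 (Y Z W : Type) (o : Y -> Z -> W) f g :
  locconst f -> locconst g -> locconst (fun t => o (f t) (g t)).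
Proof.
move=> Hf Hg t; have [m Hm] := Hf t; have [n Hn] := Hg t; exists (maxn m n) => t' a.
by rewrite Hm ?Hn //; apply: agree_leq a; [exact: leq_maxr|exact: leq_maxl].
Qed.

Lemma locconst_rel b x y :
  locconst (fun t : structure TL T => @rel_interp TL T t b [tuple x; y]).
Proof.
move=> t; eexists (pickle (existT _ b _)).+1 => t' [_ a].
by apply/esym; apply: a; exact: leqnn.
Qed.

Lemma locconst_adj x y : locconst (fun t => adj t x y).
Proof. exact: locconst_rel. Qed.

Lemma locconst_ord x y : locconst (fun t => order_rel t x y).
Proof. exact: locconst_rel. Qed.

Lemma locconst_spine r q : locconst (fun t => spine t r q).
Proof.
elim: q => [|x q IHq] /=; first exact: locconst_const.
apply: locconst2; first exact: locconst_adj.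
by apply: locconst2 => //; exact: locconst_const.
Qed.

Lemma locconst_all2 q u : locconst (fun t => all2 (order_rel t) q u).
Proof.
elim: q u => [|x q IHq] [|y u] /=; try exact: locconst_const.
by apply: locconst2 => //; exact: locconst_ord.
Qed.

Lemma locconst_elem r x : locconst (fun t => elem t r x).
Proof.
apply: (locconst2 (fun a b => a && ~~ b)); first exact: locconst_adj.
exact: locconst_ord.
Qed.

Lemma locconst_cnt r k : locconst (fun t => cnt (elem t r) k).
Proof.
rewrite /cnt; elim: (iota 0 k) => [|i s IHs] /=; first exact: locconst_const.
apply: locconst2 => //; case: (@pickle_inv T i) => [x|] /=; last exact: locconst_const.
apply: (locconst2 (fun (a : bool) _ => nat_of_bool a) (g := fun=> tt)).
  exact: locconst_elem.
exact: locconst_const.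
Qed.

(** A fact is witnessed by one finite path; that this path is a spine with the required classes
    involves only finitely many atomic relations. *)
Lemma fact_open t r m a s : fact t r m a s ->
  exists n, forall t' : structure TL T, agree n t t' -> fact t' r m a s.
Proof.
case=> q sq Hq; have [m1 H1] := locconst_spine r q t.
have [m2 H2] := locconst_all2 q (r :: a :: s ++ nseq m r) t.
exists (maxn m1 m2) => t' ag; exists q.
  by rewrite H1 //; apply: agree_leq ag; exact: leq_maxl.
by rewrite H2 //; apply: agree_leq ag; exact: leq_maxr.
Qed.

Lemma rootb_closed x y z z' :
  limit_closed [set t : structure TL T | forall u u', rootb t x y z z' u u'].
Proof.
move=> t Ht u u'.
have [n Hn] : exists n, forall t', agree n t t' ->
    rootb t' x y z z' u u' = rootb t x y z z' u u'.
  suff : locconst (fun t => rootb t x y z z' u u') by exact.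
  rewrite /rootb; apply: locconst2; first exact: locconst_const.
  apply: locconst2; first exact: locconst_adj.
  apply: locconst2; first exact: locconst_adj.
  apply: locconst2; first exact: locconst_ord.
  apply: locconst2.
    apply: locconst2; last exact: locconst_const.
    by apply: locconst2; exact: locconst_adj.
  apply: locconst2; last exact: locconst_const.
  apply: locconst2; first exact: locconst_adj.
  apply: locconst2; first exact: locconst_adj.
  by apply: locconst2; exact: locconst_ord.
by have [t' Ht' /Hn <-] := Ht n; exact: Ht'.
Qed.

Lemma agree_forall (I : countType) (P : set (structure TL T)) t (Q : I -> structure TL T -> Prop) N :
  (forall x, exists n, forall t', P t' -> agree n t t' -> Q x t') ->
  exists n, forall t', P t' -> agree n t t' -> forall x, pickle x < N -> Q x t'.
Proof.
move=> HQ; elim: N => [|N [n IHn]]; first by exists 0.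
have [[x Ex]|nx] := pselect (exists x : I, pickle x = N); last first.
  exists n => t' Pt' a x; rewrite ltnS leq_eqVlt => /predU1P[E|]; last exact: IHn.
  by case: nx; exists x.
have [m Hm] := HQ x; exists (maxn m n) => t' Pt' a y.
rewrite ltnS leq_eqVlt => /predU1P[|]; last first.
  by apply: IHn => //; apply: agree_leq a; exact: leq_maxr.
rewrite -Ex => /(pcan_inj pickleK) ->; apply: Hm => //.
by apply: agree_leq a; exact: leq_maxl.
Qed.

End LocallyConstant.

Lemma limit_closed_agree (L : language) (T : countType) (P : set (structure L T)) m M0 :
  limit_closed P -> limit_closed (P `&` [set M | agree m M0 M]).
Proof.
move=> clP M HM; split; first by apply: clP => n; have [N [PN _] aN] := HM n; exists N.
by have [N [_ aN] aM] := HM m; apply: agree_trans aN (agree_sym aM).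
Qed.

Lemma splitting_agree (L : language) (T : countType) (P : set (structure L T)) m M0 :
  splitting P -> splitting (P `&` [set M | agree m M0 M]).
Proof.
move=> spP M n [PM aM]; have [N [PN aN NM]] := spP M (maxn m n) PM; exists N; split=> //.
  split=> //; apply: agree_trans aM _; apply: agree_leq aN; exact: leq_maxl.
by apply: agree_leq aN; exact: leq_maxr.
Qed.

(** * Pulling countably or perfectly many models back from trees *)

Section Transfer.
Variables (C : countType) (L : language) (phi : sentence L) (k : nat).
Local Notation TL := (tree_language C).
Variable psi : sentence TL.
Hypothesis psi_tree : entails psi (tree_equivalence_sentence C).
Hypothesis psi_code : forall (A : countType) (M : structure L A), inhabited A ->
  satisfies M phi -> satisfies (wtree C (facts M)) psi.
Hypothesis psi_decode : forall (T : countType) (t : structure TL T), satisfies t psi ->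
  exists2 r, coded L t r &
    forall (A : countType) (M : structure L A) (h : vtx (facts M) -> T),
      inhabited A -> is_iso (wtree C (facts M)) t h -> h (vroot (facts M)) = r ->
      satisfies M phi.
Hypothesis phi_card : forall (A : countType) (M : structure L A), inhabited A ->
  satisfies M phi -> exists b : card_type k -> A, bijective b.

(** For each listed tree that is isomorphic to the tree of a model of [phi], one such model is
    chosen; any other is isomorphic to it by [wtree_iso_reflect]. [K0] fills the remaining
    indices. *)
Lemma countably_many_pull_back :
  countably_many_models psi -> countably_many_models phi.
Proof.
case=> M HM; pose K0 : countable_structure L :=
  @CountableStructure L unit (inhabits tt) (fun=> tt, fun=> true).
have /choice[N HN] : forall i, exists N : countable_structure L,
    forall K : countable_structure L, satisfies K phi ->
    isomorphic (wtree C (facts K)) (M i) -> isomorphic K N.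
  move=> i; have [[N [Nphi iN]]|nN] := pselect (exists N : countable_structure L,
      satisfies N phi /\ isomorphic (wtree C (facts N)) (M i)); last first.
    by exists K0 => K Kphi iK; case: nN; exists K.
  exists N => K Kphi iK; apply: (@wtree_iso_reflect C); [exact: universe_inh|exact: universe_inh|].
  exact: isomorphic_trans iK (isomorphic_sym iN).
exists N => K Kphi.
have [i iK] := HM (CountableStructure (inhabits (vroot (facts K))) (wtree C (facts K)))
  (psi_code (universe_inh K) Kphi).
by exists i; exact: HN.
Qed.

(** The ranks determine [e], and the facts then determine [M], so a tree has at most one
    decoding. *)
Definition decodes (T : countType) (t : structure TL T) (x : T)
    (M : structure L (card_type k)) (e : card_type k -> T) : Prop :=
  [/\ forall i, elem t x (e i), forall i, cnt (elem t x) (pickle (e i)) = card_val i,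
      forall m a s, facts M m a s <-> fact t x m (e a) (map e s),
      isomorphic (wtree C (facts M)) t & satisfies M phi].

(** The structure is first reconstructed on the set of elements itself, where [phi_card] gives its
    cardinality, and then again on the fixed universe [card_type k] along the enumeration by rank.
    Uniqueness of the root is carried over from the word tree. *)
Lemma decode_ex (T : countType) (t : structure TL T) : inhabited T -> satisfies t psi ->
  exists r, [/\ rootlike t r, forall x, rootlike t x -> x = r &
                exists M e, decodes t r M e].
Proof.
move=> iT tpsi; have [r cr rphi] := psi_decode tpsi.
have /tree_equivalence_sentenceP[tt te] := psi_tree iT tpsi.
pose A : countType := {x : T | elem t r x}.
have valE x : elem t r x <-> exists a : A, val a = x.
  by split=> [Hx|[a <-]]; [exists (exist (fun x => elem t r x) x Hx)|exact: valP].
have [M [h ih [hr _]]] := coded_reconstruct tt te cr (@val_inj _ _ A) valE.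
have iA : inhabited A.
  have [_ [[a nar] br _] _] := cr; have [_ ordC ordT] := te.
  have /br[[|y [|z q]] //=] : body ((order_rel t)^~ r) [:: a] by rewrite /= (negPf nar).
    rewrite !andbT => /andP[ry _] ya.
    suff /valE[b _] : elem t r y by exists.
    by rewrite /elem ry; apply: contra nar; apply: ordT; rewrite ordC.
  by rewrite andbF.
have [[h' hK h'K] _ _] := ih.
exists r; split.
- rewrite -hr; apply: rootlike_iso ih _; exact/(wtree_rootlike C (facts_dummy M)).
- move=> x Hx; rewrite -hr -(h'K x); congr h.
  apply/(wtree_rootlike C (facts_dummy M) _ iA).
  exact: rootlike_iso (is_iso_sym hK h'K ih) Hx.
- have [b bb] := phi_card iA (rphi _ _ _ iA ih hr).
  have [|e [ei eE ec]] := @rank_enum T (elem t r) k.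
    have [b' bK b'K] := bb.
    exists (fun i => val (b i)); first by move=> i j /val_inj/(bij_inj bb).
    move=> x; split=> [/valE[a <-]|[i <-]]; last exact: valP.
    by exists (b' a); rewrite b'K.
  have [N [h2 ih2 [h2r h2e]]] := coded_reconstruct tt te cr ei eE.
  exists N, e; split=> //.
  + by move=> i; apply/eE; exists i.
  + move=> m a s; rewrite -(fact_vemb C) (fact_iso ih2) h2r h2e -map_comp.
    by rewrite (eq_map (g := e)).
  + by exists h2.
  + by apply: (rphi _ _ _ _ ih2 h2r); case: iA => a; have [b' _ _] := bb; exists; exact: b' a.
Qed.

Lemma perfectly_many_pull_back :
  perfectly_many_models psi -> perfectly_many_models phi.
Proof.
case=> T [P [iT P0 pP Ppsi Piso]].
have clP := perfect_set_limit_closed pP; have spP := perfect_set_splitting pP.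
(* [D n] fixes a root together with the existential witnesses of [rootlike]. These closed sets cover
   [P], so one of them contains a relatively open part [Q] of [P]. *)
pose D n : set (structure TL T) := if unpickle n is Some (x, y, z, z') then
  [set t | forall u u', rootb t x y z z' u u'] else set0.
have clD n : limit_closed (D n).
  rewrite /D; case: (unpickle n) => [[[[x y] z] z']|]; first exact: rootb_closed.
  by move=> t /(_ 0)[].
have cov : P `<=` \bigcup_n D n.
  move=> t /Ppsi/(decode_ex iT)[x [[y [z [z' H]]] _ _]].
  by exists (pickle (x, y, z, z')); [exact: I|rewrite /D pickleK].
have [n [m [t0 [Pt0 HD]]]] := limit_closed_baire P0 clP clD cov.
pose Q := P `&` [set t | agree m t0 t].
have Q0 : Q t0 by split=> //; exact: agree_refl.
have clQ : limit_closed Q by exact: limit_closed_agree.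
have spQ : splitting Q by exact: splitting_agree.
have [x Hx] : exists x, forall t, Q t -> rootlike t x.
  have := HD t0 Pt0 (agree_refl _ _); rewrite /D.
  case E : (unpickle n) => [[[[x y] z] z']|] // _.
  by exists x => t [Pt /(HD t Pt)]; rewrite /D E => H; exists y, z, z'.
have dec_ex t : Q t -> exists M e, decodes t x M e.
  move=> Qt; have [r [_ ru dr]] := decode_ex iT (Ppsi _ Qt.1).
  by rewrite (ru _ (Hx _ Qt)).
have [M0 [e0 _]] := dec_ex _ Q0.
have /choice[d Hd] : forall t, exists Me : structure L (card_type k) * (card_type k -> T),
    Q t -> decodes t x Me.1 Me.2.
  move=> t; have [/dec_ex[M [e H]]|nQ] := pselect (Q t); last by exists (M0, e0).
  by exists (M, e).
(* Near [t] the vertex remains an element and keeps its rank, so it is still the one enumerated at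
   [i]. *)
have e_stable t i : Q t -> exists l, forall t', Q t' -> agree l t t' -> (d t').2 i = (d t).2 i.
  move=> Qt; have [el ec _ _ _] := Hd _ Qt.
  have [l1 H1] := locconst_elem x ((d t).2 i) t.
  have [l2 H2] := locconst_cnt x (pickle ((d t).2 i)) t.
  exists (maxn l1 l2) => t' Qt' a; have [el' ec' _ _ _] := Hd _ Qt'.
  apply: (rank_inj (el' i)).
    by rewrite H1 ?el //; apply: agree_leq a; exact: leq_maxl.
  by rewrite ec' H2 ?ec //; apply: agree_leq a; exact: leq_maxr.
have map_stable t s : Q t -> exists l, forall t', Q t' -> agree l t t' ->
    map (d t').2 s = map (d t).2 s.
  move=> Qt; elim: s => [|i s [l1 H1]]; first by exists 0.
  have [l2 H2] := e_stable t i Qt; exists (maxn l1 l2) => t' Qt' a /=.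
  by rewrite H1 ?H2 //; apply: agree_leq a; [exact: leq_maxr|exact: leq_maxl].
have fact_stable t j a s : Q t -> facts (d t).1 j a s ->
    exists l, forall t', Q t' -> agree l t t' -> facts (d t').1 j a s.
  move=> Qt; have [_ _ fE _ _] := Hd _ Qt; move/fE => /fact_open[l1 H1].
  have [l2 H2] := map_stable t (a :: s) Qt; exists (maxn l1 l2) => t' Qt' ag.
  have [_ _ fE' _ _] := Hd _ Qt'; apply/fE'.
  have [-> ->] := H2 t' Qt' (agree_leq (leq_maxr l1 l2) ag).
  by apply: H1; apply: agree_leq ag; exact: leq_maxl.
have iK : inhabited (card_type k) by case: (k) => [|k']; exists; [exact: 0|exact: ord0].
(* Only the presence of a mark is stable. A function value is fixed by the mark of the graph at that
   value; for a relation the mark used has as polarity the truth value [b] at [t], so it is present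
   at [t] and remains so nearby. *)
have d_cont t N : Q t -> exists l, forall t', Q t' -> agree l t t' -> agree N (d t).1 (d t').1.
  move=> Qt.
  have [|l1 H1] := @agree_forall C T {f : fsym L & (fun_arity f).-tuple (card_type k)} Q t
    (fun v t' => (d t).1.1 v = (d t').1.1 v) N.
    case=> c v; pose y := fun_interp (d t).1 v.
    have [|l Hl] := fact_stable t (fcode c) y v Qt.
      by rewrite facts_fcode mktuple_nth eqxx.
    exists l => t' Qt' /(Hl t' Qt').
    by rewrite facts_fcode mktuple_nth => /eqP /esym.
  have [|l2 H2] := @agree_forall C T {f : rsym L & (rel_arity f).-tuple (card_type k)} Q t
    (fun v t' => (d t).1.2 v = (d t').1.2 v) N.
    case=> c v; pose b := rel_interp (d t).1 v; case: iK => i0.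
    have factE M : facts M (pickle (Some (b, inl c) : symb L)) i0 v = (b == rel_interp M v).
      by rewrite /facts pickleK mktuple_nth.
    have [|l Hl] := fact_stable t (pickle (Some (b, inl c) : symb L)) i0 v Qt.
      by rewrite factE.
    by exists l => t' Qt' /(Hl t' Qt'); rewrite factE => /eqP.
  exists (maxn l1 l2) => t' Qt' a; split=> v; [apply: H1|apply: H2] => //;
    by apply: agree_leq a; rewrite ?leq_maxl ?leq_maxr.
have [f [Qf fc fi]] := cantor_scheme (ex_intro _ t0 Q0) clQ spQ.
apply: (@cantor_perfectly_many L (card_type k) phi (fun a => (d (f a)).1)) => //.
- by move=> a; have [] := Hd _ (Qf a).
(* Isomorphic decoded structures have isomorphic word trees, hence come from isomorphic members of
   [P], which are equal. *)
- move=> a b [g ig]; apply: fi; apply: Piso; [exact: (Qf a).1|exact: (Qf b).1|].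
  have [_ _ _ ia _] := Hd _ (Qf a); have [_ _ _ ib _] := Hd _ (Qf b).
  apply: isomorphic_trans (isomorphic_sym ia) _; apply: isomorphic_trans _ ib.
  by have [bg _ _] := ig; apply: (wtree_iso C bg); exact: facts_iso.
- move=> a N; have [l Hl] := d_cont _ N (Qf a); exists l => b ab.
  by apply: Hl => //; exact: fc.
Qed.

End Transfer.

(** * Splitting a sentence by the cardinality of its models *)

Section Cardinality.
Variable L : language.

Definition has_card (k : nat) (T : countType) : Prop :=
  if k is 0 then forall n, exists q : seq T, size q = n /\ uniq q
  else exists q : seq T, [/\ size q = k, uniq q & forall x, x \in q].

Lemma has_card_sentence k : exists chi : sentence L,
  forall (T : countType) (M : structure L T), satisfies M chi <-> has_card k T.
Proof.
apply: definable_sentence; rewrite /has_card.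
have dsize (Y : finType) (vs : seq Y) n : definable (fun T (M : structure L T) (e : Y -> T) =>
    size (map e vs) = n).
  by apply: (def_ext _ (def_const L Y (size vs = n))) => T M e; rewrite size_map.
case: k => [|k].
  apply: (def_bigand (P := fun n T M e => exists q : seq T, size q = n /\ uniq q)) => n.
  by apply: def_exs => Y g vs; cbv beta; apply: def_and; [exact: dsize|exact: def_uniq].
apply: def_exs => Y g vs; cbv beta.
apply: (@def_ext _ _ (fun T M e => (size (map e vs) = k.+1 /\ uniq (map e vs)) /\
    forall x, x \in map e vs)); first by move=> T M e; split=> [[[]]|[]].
apply: def_and; first by apply: def_and; [exact: dsize|exact: def_uniq].
apply: def_all => Z h v; cbv beta.
by apply: (def_ext _ (def_in L v (map h vs))) => T M e; rewrite -map_comp.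
Qed.

Lemma has_card_ex (T : countType) : inhabited T -> exists k, has_card k T.
Proof.
case=> x0; have [inf|/existsNP[n Hn]] := pselect (has_card 0 T); first by exists 0.
(* The least length of which there is no sequence without repetition is one more than the
   cardinality. *)
have /ex_minnP[[|k]] : exists n, `[< ~ exists q : seq T, size q = n /\ uniq q >].
- by exists n; apply/asboolP.
- by move=> /asboolP[]; exists [::].
move=> /asboolP nk /(_ k); rewrite ltnn => mink.
have [q [sq uq]] : exists q : seq T, size q = k /\ uniq q.
  by apply: contrapT => /asboolP /mink.
have qT x : x \in q.
  apply: contrapT => /negP nx; apply: nk; exists (x :: q); rewrite /= sq nx.
  by split.
by case: k sq {nk mink} => [|k] sq; [move: (qT x0); rewrite (size0nil sq)|exists k.+1, q].
Qed.

Lemma has_card_bij k (T : countType) : has_card k T ->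
  exists b : card_type k -> T, bijective b.
Proof.
case: k => [inf|k [q [sq uq qT]]]; last first.
  have sq' : size q == k.+1 by apply/eqP.
  pose v : k.+1.-tuple T := Tuple sq'; exists (tnth v).
  have iq x : index x q < k.+1 by rewrite -sq index_mem.
  exists (fun x => Ordinal (iq x)).
    move=> i; apply: val_inj => /=; rewrite (tnth_nth (tnth v i)) index_uniq //.
    by rewrite sq.
  by move=> x; rewrite (tnth_nth x) /= nth_index.
have /choice[b Hb] : forall i : nat, exists x : T, cnt (@predT T) (pickle x) = i.
  move=> i; have [q [sq uq]] := inf i.+1; have sq' : size q == i.+1 by apply/eqP.
  have vi : injective (tnth (Tuple sq')) by apply/tuple_uniqP.
  by have [x _ Ex] := @rank_surj _ predT _ _ vi (fun=> isT); exists x.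
exists b; exists (fun x => cnt (@predT T) (pickle x)) => // x.
by apply: (@rank_inj T predT) => //; rewrite Hb.
Qed.

End Cardinality.

(** The sentences [phi_ k] split the countable models of [phi] into countably many cases. A perfect
    set for one case serves [phi]; if there is none, the countable lists are merged. The set [C] of
    constants is arbitrary, which covers rooted and unrooted trees alike. *)
Lemma tree_equivalence_VC_complete (C : countType) :
  VC_complete (tree_equivalence_sentence C).
Proof.
move=> sVC L phi; have /choice[chi Hchi] := has_card_sentence L.
pose phi_ k := And2 phi (chi k).
have phiE k (T : countType) (M : structure L T) :
    satisfies M (phi_ k) <-> satisfies M phi /\ has_card k T.
  by rewrite satisfies_And2 Hchi.
have VCk k : satisfies_VC (phi_ k).
  have [psi [p1 p2 p3]] := coding_sentence C (phi_ k).
  have card (A : countType) (M : structure L A) : inhabited A -> satisfies M (phi_ k) ->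
      exists b : card_type k -> A, bijective b.
    by move=> _ /phiE[_ /has_card_bij].
  have [cM|pM] := sVC psi p1; [left|right].
    exact: countably_many_pull_back p2 cM.
  exact: perfectly_many_pull_back p1 p3 card pM.
have [[k [T [P [iT P0 pP sP nP]]]]|np] := pselect (exists k, perfectly_many_models (phi_ k)).
  by right; exists T, P; split=> // M PM; have [] := (phiE k T M).1 (sP M PM).
left; have /choice[M HM] : forall k, countably_many_models (phi_ k).
  by move=> k; case: (VCk k) => // pk; case: np; exists k.
exists (fun n => if unpickle n is Some (k, i) then M k i else M 0 0) => N Nphi.
have [k kN] := has_card_ex (universe_inh N).
have [i iN] := HM k N ((phiE k _ _).2 (conj Nphi kN)).
by exists (pickle (k, i)); rewrite pickleK.
Qed.

Theorem theorem4p8 :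
  VC_complete rooted_sentence /\ VC_complete unrooted_sentence.
Proof. by split; exact: tree_equivalence_VC_complete. Qed.
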